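(* Let $(H,\beta)$ be a Hom-bialgebra over a field $K$. Let $(A,\alpha)$ be a left $(H,\beta)$-module Hom-algebra with action $\rhd:H\otimes A\to A$ and a left $(H,\beta)$-comodule Hom-coalgebra with coaction $\rho:A\to H\otimes A$, $\rho(a)=a_{-1}\otimes a_0$ (so $A$ carries both a Hom-algebra and a Hom-coalgebra structure with the same structure automorphism $\alpha$). Then the following are equivalent. (I) The vector space $A\otimes H$ with the automorphism $\alpha\otimes\beta$, the smash product multiplication and unit $1_A\otimes 1_H$, and the smash coproduct comultiplication and counit $\varepsilon_A\otimes\varepsilon_H$, i.e. $$(a\otimes h)(a'\otimes h')=a(h_1\rhd\alpha^{-1}(a'))\otimes\beta^{-1}(h_2)h',$$ $$\Delta(a\otimes h)=a_1\otimes a_{2\,-1}\beta^{-1}(h_1)\otimes\alpha^{-1}(a_{2\,0})\otimes h_2,$$ is a Hom-bialgebra. (II) The following conditions hold for all $a,b\in A$ and $h\in H$: (R1) $(A,\rho,\alpha)$ is an $(H,\beta)$-comodule Hom-algebra; (R2) $(A,\rhd,\alpha)$ is an $(H,\beta)$-module Hom-coalgebra; (R3) $\varepsilon_A$ is a Hom-algebra map (i.e. $\varepsilon_A(ab)=\varepsilon_A(a)\varepsilon_A(b)$, $\varepsilon_A(1_A)=1$) and $\Delta_A(1_A)=1_A\otimes1_A$; (R4) $\Delta_A(ab)=a_1\bigl(\beta^2(a_{2\,-1})\rhd\alpha^{-1}(b_1)\bigr)\otimes\alpha^{-1}(a_{2\,0})b_2$; (R5) $h_1\beta(a_{-1})\otimes(\beta^3(h_2)\rhd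 a_0)=(\beta^2(h_1)\rhd a)_{-1}h_2\otimes(\beta^2(h_1)\rhd a)_0$. (In this case the Hom-bialgebra in (I) is called the Radford biproduct Hom-bialgebra.)
   Context: All spaces are over a field $K$. Sweedler-type notation: $\Delta(c)=c_1\otimes c_2$, $\Delta(c_1)=c_{11}\otimes c_{12}$, etc., summation understood; $a_{2\,-1}\otimes a_{2\,0}=\rho(a_2)$. Hom-algebra $(A,\mu,1_A,\alpha)$ (abbr. $(A,\alpha)$): a vector space $A$, a linear map $\mu:A\otimes A\to A$, $a\otimes a'\mapsto aa'$, an element $1_A\in A$ and a bijective linear map $\alpha:A\to A$ with $\alpha(aa')=\alpha(a)\alpha(a')$, $\alpha(1_A)=1_A$, $\alpha(a)(a'a'')=(aa')\alpha(a'')$, $a1_A=1_Aa=\alpha(a)$. Hom-coalgebra $(C,\Delta,\varepsilon_C,\beta)$ (abbr. $(C,\beta)$): a vector space $C$, linear maps $\Delta:C\to C\otimes C$, $\varepsilon_C:C\to K$ and a bijective linear map $\beta:C\to C$ with $\Delta(\beta(c))=\beta(c_1)\otimes\beta(c_2)$, $\varepsilon_C\circ\beta=\varepsilon_C$, $\beta(c_1)\otimes c_{21}\otimes c_{22}=c_{11}\otimes c_{12}\otimes\beta(c_2)$, $\varepsilon_C(c_1)c_2=c_1\varepsilon_C(c_2)=\beta(c)$. Hom-bialgebra $(H,\mu,1_H,\Delta,\varepsilon,\beta)$ (abbr. $(H,\beta)$): $(H,\mu,1_H,\beta)$ is a Hom-algebra, $(H,\Delta,\varepsilon,\beta)$ is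 a Hom-coalgebra, and $\Delta(hh')=h_1h'_1\otimes h_2h'_2$, $\Delta(1_H)=1_H\otimes1_H$, $\varepsilon(hh')=\varepsilon(h)\varepsilon(h')$, $\varepsilon(1_H)=1$. Left $(H,\beta)$-Hom-module $(M,\rhd,\alpha)$ over a Hom-algebra $(H,\beta)$: a vector space $M$, a linear map $\rhd:H\otimes M\to M$ and a bijective linear map $\alpha:M\to M$ with $\alpha(h\rhd m)=\beta(h)\rhd\alpha(m)$, $\beta(h)\rhd(h'\rhd m)=(hh')\rhd\alpha(m)$, $1_H\rhd m=\alpha(m)$. Left $(H,\beta)$-Hom-comodule $(M,\rho,\alpha)$ over a Hom-coalgebra $(H,\beta)$: a vector space $M$, a linear map $\rho:M\to H\otimes M$, $\rho(m)=m_{-1}\otimes m_0$, and a bijective linear map $\alpha:M\to M$ with $\rho(\alpha(m))=\beta(m_{-1})\otimes\alpha(m_0)$, $\beta(m_{-1})\otimes m_{0\,-1}\otimes m_{0\,0}=m_{-1\,1}\otimes m_{-1\,2}\otimes\alpha(m_0)$, $\varepsilon(m_{-1})m_0=\alpha(m)$. Let $(H,\beta)$ be a Hom-bialgebra. - $(H,\beta)$-module Hom-algebra $(A,\rhd,\alpha)$: $(A,\alpha)$ is a Hom-algebra, $(A,\rhd,\alpha)$ is a left $(H,\beta)$-Hom-module, $\beta^2(h)\rhd(aa')=(h_1\rhd a)(h_2\rhd a')$ and $h\rhd1_A=\varepsilon(h)1_A$. - $(H,\beta)$-comodule Hom-coalgebra $(C,\rho,\alpha)$: $(C,\alpha)$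 is a Hom-coalgebra, $(C,\rho,\alpha)$ is a left $(H,\beta)$-Hom-comodule, $\beta^2(c_{-1})\otimes c_{0\,1}\otimes c_{0\,2}=c_{1\,-1}c_{2\,-1}\otimes c_{1\,0}\otimes c_{2\,0}$ and $c_{-1}\varepsilon_C(c_0)=1_H\varepsilon_C(c)$. - $(H,\beta)$-module Hom-coalgebra $(C,\rhd,\alpha)$: $(C,\alpha)$ is a Hom-coalgebra, $(C,\rhd,\alpha)$ is a left $(H,\beta)$-Hom-module, $\Delta(h\rhd c)=(h_1\rhd c_1)\otimes(h_2\rhd c_2)$ and $\varepsilon_C(h\rhd c)=\varepsilon(h)\varepsilon_C(c)$. - $(H,\beta)$-comodule Hom-algebra $(A,\rho,\alpha)$: $(A,\alpha)$ is a Hom-algebra, $(A,\rho,\alpha)$ is a left $(H,\beta)$-Hom-comodule, $\rho(aa')=a_{-1}a'_{-1}\otimes a_0a'_0$ and $\rho(1_A)=1_H\otimes1_A$. It is known that, under the hypotheses, $A\otimes H$ with the given multiplication is a Hom-algebra and with the given comultiplication is a Hom-coalgebra (both with automorphism $\alpha\otimes\beta$). *)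

(* Defs.v *)
From HB Require Import structures.
From mathcomp Require Import all_boot all_algebra generic_quotient.
From mathcomp Require Import boolp classical_sets.

Set Implicit Arguments.
Unset Strict Implicit.
Unset Printing Implicit Defensive.

Import GRing.Theory.

Local Open Scope ring_scope.
Local Open Scope quotient_scope.

Reserved Notation "x ⊗ y" (at level 40, left associativity).
Reserved Notation "\tsum_ ( x ⊗ y <- t ) F"
  (at level 41, F at level 41, x name, y name, t at level 50,
   format "'[' \tsum_ ( x  ⊗  y  <-  t ) '/  '  F ']'").

(* A formal sum u_1 ⊗ v_1 + ... + u_n ⊗ v_n is represented by the list of its
   pairs (u_i, v_i).  No coefficients are needed: k (u ⊗ v) = (k u) ⊗ v.  The
   tensor product is the quotient by the congruence generated by commutativity
   and bilinearity; [tsum_pure], [tsum_linear] and [tensor_ext] below give its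
   universal property. *)
Section TensorProduct.
Variables (K : fieldType) (U V : lmodType K).

Inductive tensor_rel : seq (U * V) -> seq (U * V) -> Prop :=
| TRrefl s : tensor_rel s s
| TRsym s t : tensor_rel s t -> tensor_rel t s
| TRtrans s t r : tensor_rel s t -> tensor_rel t r -> tensor_rel s r
| TRcat s s' t t' :
    tensor_rel s s' -> tensor_rel t t' -> tensor_rel (s ++ t) (s' ++ t')
| TRcomm s t : tensor_rel (s ++ t) (t ++ s)
| TRaddl u u' v : tensor_rel [:: (u + u', v)] [:: (u, v); (u', v)]
| TRaddr u v v' : tensor_rel [:: (u, v + v')] [:: (u, v); (u, v')]
| TRscale k u v : tensor_rel [:: (k *: u, v)] [:: (u, k *: v)]
| TRzero v : tensor_rel [:: (0, v)] [::].

Definition tensor_relb s t := `[< tensor_rel s t >].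

Lemma tensor_relb_refl : reflexive tensor_relb.
Proof. by move=> s; apply/asboolP; apply: TRrefl. Qed.

Lemma tensor_relb_sym : symmetric tensor_relb.
Proof. by move=> s t; apply/asboolP/asboolP => ?; apply: TRsym. Qed.

Lemma tensor_relb_trans : transitive tensor_relb.
Proof.
by move=> t s r /asboolP st /asboolP tr; apply/asboolP; apply: TRtrans st tr.
Qed.

Canonical tensor_equiv :=
  EquivRel tensor_relb tensor_relb_refl tensor_relb_sym tensor_relb_trans.

Definition tensor : Type := {eq_quot tensor_equiv}.
HB.instance Definition _ : EqQuotient _ tensor_equiv tensor :=
  EqQuotient.on tensor.
HB.instance Definition _ := Choice.on tensor.

Lemma tensor_piP s t : \pi_tensor s = \pi_tensor t <-> tensor_rel s t.
Proof.
by split=> [/eqmodP/asboolP|st]; last by apply/eqmodP/asboolP.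
Qed.

Lemma tensor_repr s : tensor_rel (repr (\pi_tensor s)) s.
Proof. by apply/tensor_piP; rewrite reprK. Qed.

Definition pure (u : U) (v : V) : tensor := \pi_tensor [:: (u, v)].

Definition tensor_zero : tensor := \pi_tensor [::].
Definition tensor_add (x y : tensor) : tensor := \pi_tensor (repr x ++ repr y).
Definition scale_seq (k : K) (s : seq (U * V)) := [seq (k *: p.1, p.2) | p <- s].
Definition tensor_scale (k : K) (x : tensor) : tensor :=
  \pi_tensor (scale_seq k (repr x)).
Definition tensor_opp (x : tensor) := tensor_scale (-1) x.

Lemma tensor_add_pi s t :
  tensor_add (\pi_tensor s) (\pi_tensor t) = \pi_tensor (s ++ t).
Proof. by apply/tensor_piP; apply: TRcat; apply: tensor_repr. Qed.

Lemma scale_seq_rel k s t :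
  tensor_rel s t -> tensor_rel (scale_seq k s) (scale_seq k t).
Proof.
elim=> {s t}.
- by move=> s; apply: TRrefl.
- by move=> s t _ ?; apply: TRsym.
- by move=> s t r _ st _; apply: TRtrans.
- by move=> s s' t t' _ ? _ ?; rewrite /scale_seq !map_cat; apply: TRcat.
- by move=> s t; rewrite /scale_seq !map_cat; apply: TRcomm.
- by move=> u u' v /=; rewrite scalerDr; apply: TRaddl.
- by move=> u v v' /=; apply: TRaddr.
- by move=> l u v /=; rewrite scalerA mulrC -scalerA; apply: TRscale.
- by move=> v /=; rewrite scaler0; apply: TRzero.
Qed.

Lemma tensor_scale_pi k s :
  tensor_scale k (\pi_tensor s) = \pi_tensor (scale_seq k s).
Proof. by apply/tensor_piP; apply: scale_seq_rel; apply: tensor_repr. Qed.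

Lemma scale_seq_zero s : tensor_rel (scale_seq 0 s) [::].
Proof.
elim: s => [|[u v] s IHs] /=; first exact: TRrefl.
by rewrite scale0r -[[::]]cats0; apply: (TRcat (TRzero _) IHs).
Qed.

Lemma scale_seqD k l s :
  tensor_rel (scale_seq (k + l) s) (scale_seq k s ++ scale_seq l s).
Proof.
elim: s => [|[u v] s IHs] /=; first exact: TRrefl.
rewrite scalerDl.
apply: TRtrans (TRcat (TRaddl _ _ _) IHs) _ => /=.
set S := scale_seq k s; set T := scale_seq l s.
have -> : (k *: u, v) :: S ++ (l *: u, v) :: T =
          [:: (k *: u, v)] ++ ((S ++ [:: (l *: u, v)]) ++ T) by rewrite -catA.
apply: (TRcat (TRrefl [:: (k *: u, v)])).
exact: (TRcat (TRcomm [:: (l *: u, v)] S) (TRrefl T)).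
Qed.

Lemma tensor_addA : associative tensor_add.
Proof.
elim/quotW=> r; elim/quotW=> s; elim/quotW=> t.
by rewrite (tensor_add_pi s t) (tensor_add_pi r s) !tensor_add_pi catA.
Qed.

Lemma tensor_addC : commutative tensor_add.
Proof.
elim/quotW=> s; elim/quotW=> t; rewrite !tensor_add_pi.
by apply/tensor_piP; apply: TRcomm.
Qed.

Lemma tensor_add0 : left_id tensor_zero tensor_add.
Proof. by elim/quotW=> s; rewrite tensor_add_pi. Qed.

Lemma tensor_addN : left_inverse tensor_zero tensor_opp tensor_add.
Proof.
elim/quotW=> s; rewrite /tensor_opp tensor_scale_pi tensor_add_pi.
apply/tensor_piP; apply: TRtrans (scale_seq_zero s).
have s1 : scale_seq 1 s = s.
  by rewrite -[RHS]map_id; apply: eq_map => -[u v] /=; rewrite scale1r.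
by have := scale_seqD (-1) 1 s; rewrite addNr s1; apply: TRsym.
Qed.

HB.instance Definition _ :=
  GRing.isZmodule.Build tensor tensor_addA tensor_addC tensor_add0 tensor_addN.

Lemma tensor_scaleA k l x :
  tensor_scale k (tensor_scale l x) = tensor_scale (k * l) x.
Proof.
elim/quotW: x => s; rewrite (tensor_scale_pi l) !tensor_scale_pi.
suff -> : scale_seq k (scale_seq l s) = scale_seq (k * l) s by [].
by rewrite /scale_seq -map_comp; apply: eq_map => -[u v] /=; rewrite scalerA.
Qed.

Lemma tensor_scale1 : left_id 1 tensor_scale.
Proof.
elim/quotW=> s; rewrite tensor_scale_pi; suff -> : scale_seq 1 s = s by [].
by rewrite -[RHS]map_id; apply: eq_map => -[u v] /=; rewrite scale1r.
Qed.

Lemma tensor_scaleDr : right_distributive tensor_scale +%R.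
Proof.
move=> k; elim/quotW=> s; elim/quotW=> t.
have addE (x y : tensor) : x + y = tensor_add x y by [].
rewrite !addE (tensor_add_pi s t) !(tensor_scale_pi k) tensor_add_pi.
by rewrite /scale_seq map_cat.
Qed.

Lemma tensor_scaleDl x : {morph tensor_scale^~ x : k l / k + l}.
Proof.
move=> k l; elim/quotW: x => s.
rewrite /= !tensor_scale_pi [RHS]tensor_add_pi.
by apply/tensor_piP; apply: scale_seqD.
Qed.

HB.instance Definition _ := GRing.Zmodule_isLmodule.Build K tensor
  tensor_scaleA tensor_scale1 tensor_scaleDr tensor_scaleDl.

Lemma piD s t : \pi_tensor (s ++ t) = \pi_tensor s + \pi_tensor t.
Proof. by rewrite -tensor_add_pi. Qed.

Lemma piZ k s : \pi_tensor (scale_seq k s) = k *: \pi_tensor s.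
Proof. by rewrite -tensor_scale_pi. Qed.

(* The Sweedler sum of F over t: if t = \sum_i u_i ⊗ v_i then this is
   \sum_i F u_i v_i.  It is computed on a chosen expression of t, and does not
   depend on that choice when F is bilinear ([tsum_pi]). *)
Definition tsum (W : nmodType) (t : tensor) (F : U -> V -> W) : W :=
  \sum_(p <- repr t) F p.1 p.2.

End TensorProduct.

Arguments tensor {K} (U V)%_type_scope.
Arguments pure {K U V} u v.
Arguments tsum {K U V W} t F.

Notation "U ⊗ V" := (tensor U V) : type_scope.
Notation "u ⊗ v" := (pure u v) : ring_scope.
Notation "\tsum_ ( x ⊗ y <- t ) F" := (tsum t (fun x y => F)) : ring_scope.

Section TensorTheory.
Variables (K : fieldType) (U V : lmodType K).

Definition bilinear_map (W : lmodType K) (F : U -> V -> W) :=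
  (forall v, linear (F^~ v)) /\ (forall u, linear (F u)).

Lemma pure_bilinear : bilinear_map (fun (u : U) (v : V) => u ⊗ v).
Proof.
split=> [v k u u'|u k v v']; rewrite /pure -piZ -piD; apply/tensor_piP.
  exact: TRaddl.
apply: TRtrans (TRaddr _ _ _) _.
exact: (TRcat (TRsym (TRscale _ _ _)) (TRrefl [:: (u, v')])).
Qed.

Lemma pi_pure (s : seq (U * V)) :
  \pi_(U ⊗ V) s = \sum_(p <- s) p.1 ⊗ p.2.
Proof.
elim: s => [|[u v] s IHs]; first by rewrite big_nil.
by rewrite big_cons -IHs -piD.
Qed.

Lemma tensor_pure (t : U ⊗ V) : t = \sum_(p <- repr t) p.1 ⊗ p.2.
Proof. by rewrite -pi_pure reprK. Qed.

Variables (W : lmodType K) (F : U -> V -> W).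
Hypothesis bilF : bilinear_map F.

Let F0l v : F 0 v = 0.
Proof. by have := bilF.1 v (-1) 0 0; rewrite scaler0 addr0 scaleN1r addNr. Qed.

Let FDl u u' v : F (u + u') v = F u v + F u' v.
Proof. by have := bilF.1 v 1 u u'; rewrite !scale1r. Qed.

Let FDr u v v' : F u (v + v') = F u v + F u v'.
Proof. by have := bilF.2 u 1 v v'; rewrite !scale1r. Qed.

Let F0r u : F u 0 = 0.
Proof. by have := bilF.2 u (-1) 0 0; rewrite scaler0 addr0 scaleN1r addNr. Qed.

Let FZl k u v : F (k *: u) v = k *: F u v.
Proof. by have := bilF.1 v k u 0; rewrite !addr0 F0l addr0. Qed.

Let FZr k u v : F u (k *: v) = k *: F u v.
Proof. by have := bilF.2 u k v 0; rewrite !addr0 F0r addr0. Qed.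

Lemma tsum_pi s : tsum (\pi_(U ⊗ V) s) F = \sum_(p <- s) F p.1 p.2.
Proof.
suff sumF r t : tensor_rel r t ->
  \sum_(p <- r) F p.1 p.2 = \sum_(p <- t) F p.1 p.2.
  by apply: sumF; apply: tensor_repr.
elim=> {s r t} //.
- by move=> s t r _ -> _ ->.
- by move=> s s' t t' _ IHs _ IHt; rewrite !big_cat /= IHs IHt.
- by move=> s t; rewrite !big_cat /= addrC.
- by move=> u u' v; rewrite !big_cons !big_nil !addr0 FDl.
- by move=> u v v'; rewrite !big_cons !big_nil !addr0 FDr.
- by move=> k u v; rewrite !big_cons !big_nil !addr0 FZl FZr.
- by move=> v; rewrite big_cons !big_nil F0l addr0.
Qed.

Lemma tsum_pure u v : tsum (u ⊗ v) F = F u v.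
Proof. by rewrite tsum_pi big_seq1. Qed.

Lemma tsum_linear : linear (fun t : U ⊗ V => tsum t F).
Proof.
move=> k; elim/quotW=> s; elim/quotW=> t.
rewrite -piZ -piD !tsum_pi big_cat big_map scaler_sumr /=; congr (_ + _).
by apply: eq_bigr => p _; rewrite FZl.
Qed.

Lemma tensor_ext (f g : U ⊗ V -> W) :
  linear f -> linear g -> (forall u v, f (u ⊗ v) = g (u ⊗ v)) -> f =1 g.
Proof.
move=> linf ling fg; elim/quotW=> s; rewrite pi_pure.
have h0 (h : U ⊗ V -> W) : linear h -> h 0 = 0.
  by move/(_ (-1) 0 0); rewrite scaler0 addr0 scaleN1r addNr.
elim: s => [|p s IHs]; first by rewrite big_nil !h0.
rewrite big_cons -[p.1 ⊗ p.2]scale1r linf ling fg.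
by rewrite IHs.
Qed.

End TensorTheory.

(* Meaningful only for a bijective f (see [finvK]); the value outside the image
   of f is irrelevant. *)
Definition finv_fun (U : nmodType) (f : U -> U) (y : U) : U :=
  xget 0 [set x | f x = y]%classic.

Lemma finvK (U : nmodType) (f : U -> U) :
  bijective f -> cancel f (finv_fun f) /\ cancel (finv_fun f) f.
Proof.
move=> [g fK gK].
have fgK : cancel (finv_fun f) f.
  by move=> y; apply: (@xgetPex _ 0 [set x | f x = y]%classic); exists (g y).
by split=> // x; apply: (can_inj fK); rewrite fgK.
Qed.

(* Structure maps are given as plain functions, and linearity is a clause of
   each definition.  In Sweedler sums, m_1, m0_1 and m00 stand for m_{-1},
   m_{0,-1} and m_{0,0}, while m_11 and m_12 stand for (m_{-1})_1 and
   (m_{-1})_2; similarly for the other letters. *)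
Section HomStructures.
Variable K : fieldType.

Record hom_algebra (A : lmodType K) (mu : A ⊗ A -> A) (one : A)
    (alpha : A -> A) : Prop := HomAlgebra {
  hom_mul_linear : linear mu;
  hom_alg_aut_linear : linear alpha;
  hom_alg_aut_bij : bijective alpha;
  hom_alg_autM a a' : alpha (mu (a ⊗ a')) = mu (alpha a ⊗ alpha a');
  hom_alg_aut1 : alpha one = one;
  hom_mulA a a' a'' :
    mu (alpha a ⊗ mu (a' ⊗ a'')) = mu (mu (a ⊗ a') ⊗ alpha a'');
  hom_mulr1 a : mu (a ⊗ one) = alpha a;
  hom_mul1r a : mu (one ⊗ a) = alpha a }.

Record hom_coalgebra (C : lmodType K) (Delta : C -> C ⊗ C) (eps : C -> K)
    (beta : C -> C) : Prop := HomCoalgebra {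
  hom_comul_linear : linear Delta;
  hom_counit_linear : scalar eps;
  hom_coalg_aut_linear : linear beta;
  hom_coalg_aut_bij : bijective beta;
  hom_comul_aut c :
    Delta (beta c) = \tsum_(c1 ⊗ c2 <- Delta c) (beta c1 ⊗ beta c2);
  hom_counit_aut c : eps (beta c) = eps c;
  hom_comulA c :
    \tsum_(c1 ⊗ c2 <- Delta c) \tsum_(c21 ⊗ c22 <- Delta c2)
       (beta c1 ⊗ (c21 ⊗ c22)) =
    \tsum_(c1 ⊗ c2 <- Delta c) \tsum_(c11 ⊗ c12 <- Delta c1)
       (c11 ⊗ (c12 ⊗ beta c2));
  hom_counitl c : \tsum_(c1 ⊗ c2 <- Delta c) (eps c1 *: c2) = beta c;
  hom_counitr c : \tsum_(c1 ⊗ c2 <- Delta c) (eps c2 *: c1) = beta c }.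

Record hom_bialgebra (H : lmodType K) (mu : H ⊗ H -> H) (one : H)
    (Delta : H -> H ⊗ H) (eps : H -> K) (beta : H -> H) : Prop :=
  HomBialgebra {
  hom_bialg_alg : hom_algebra mu one beta;
  hom_bialg_coalg : hom_coalgebra Delta eps beta;
  hom_comulM h h' :
    Delta (mu (h ⊗ h')) =
    \tsum_(h1 ⊗ h2 <- Delta h) \tsum_(h1' ⊗ h2' <- Delta h')
       (mu (h1 ⊗ h1') ⊗ mu (h2 ⊗ h2'));
  hom_comul1 : Delta one = one ⊗ one;
  hom_counitM h h' : eps (mu (h ⊗ h')) = eps h * eps h';
  hom_counit1 : eps one = 1 }.

Section OverH.
Variables (H : lmodType K) (muH : H ⊗ H -> H) (oneH : H).
Variables (DeltaH : H -> H ⊗ H) (epsH : H -> K) (beta : H -> H).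

Record hom_module (M : lmodType K) (act : H ⊗ M -> M) (alpha : M -> M) :
    Prop := HomModule {
  hom_act_linear : linear act;
  hom_mod_aut_linear : linear alpha;
  hom_mod_aut_bij : bijective alpha;
  hom_act_aut h m : alpha (act (h ⊗ m)) = act (beta h ⊗ alpha m);
  hom_actA h h' m :
    act (beta h ⊗ act (h' ⊗ m)) = act (muH (h ⊗ h') ⊗ alpha m);
  hom_act1 m : act (oneH ⊗ m) = alpha m }.

Record hom_comodule (M : lmodType K) (rho : M -> H ⊗ M) (alpha : M -> M) :
    Prop := HomComodule {
  hom_coact_linear : linear rho;
  hom_comod_aut_linear : linear alpha;
  hom_comod_aut_bij : bijective alpha;
  hom_coact_aut m :
    rho (alpha m) = \tsum_(m_1 ⊗ m0 <- rho m) (beta m_1 ⊗ alpha m0);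
  hom_coactA m :
    \tsum_(m_1 ⊗ m0 <- rho m) \tsum_(m0_1 ⊗ m00 <- rho m0)
       (beta m_1 ⊗ (m0_1 ⊗ m00)) =
    \tsum_(m_1 ⊗ m0 <- rho m) \tsum_(m_11 ⊗ m_12 <- DeltaH m_1)
       (m_11 ⊗ (m_12 ⊗ alpha m0));
  hom_coact_counit m :
    \tsum_(m_1 ⊗ m0 <- rho m) (epsH m_1 *: m0) = alpha m }.

Record module_hom_algebra (A : lmodType K) (mu : A ⊗ A -> A) (one : A)
    (act : H ⊗ A -> A) (alpha : A -> A) : Prop := ModuleHomAlgebra {
  mha_alg : hom_algebra mu one alpha;
  mha_mod : hom_module act alpha;
  mha_actM h a a' :
    act (iter 2 beta h ⊗ mu (a ⊗ a')) =
    \tsum_(h1 ⊗ h2 <- DeltaH h) mu (act (h1 ⊗ a) ⊗ act (h2 ⊗ a'));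
  mha_act1 h : act (h ⊗ one) = epsH h *: one }.

Record comodule_hom_coalgebra (C : lmodType K) (Delta : C -> C ⊗ C)
    (eps : C -> K) (rho : C -> H ⊗ C) (alpha : C -> C) : Prop :=
  ComoduleHomCoalgebra {
  chc_coalg : hom_coalgebra Delta eps alpha;
  chc_comod : hom_comodule rho alpha;
  chc_coact_comul c :
    \tsum_(c_1 ⊗ c0 <- rho c) \tsum_(c01 ⊗ c02 <- Delta c0)
       (iter 2 beta c_1 ⊗ (c01 ⊗ c02)) =
    \tsum_(c1 ⊗ c2 <- Delta c)
    \tsum_(c1_1 ⊗ c10 <- rho c1) \tsum_(c2_1 ⊗ c20 <- rho c2)
       (muH (c1_1 ⊗ c2_1) ⊗ (c10 ⊗ c20));
  chc_coact_counit c :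
    \tsum_(c_1 ⊗ c0 <- rho c) (eps c0 *: c_1) = eps c *: oneH }.

Record module_hom_coalgebra (C : lmodType K) (Delta : C -> C ⊗ C)
    (eps : C -> K) (act : H ⊗ C -> C) (alpha : C -> C) : Prop :=
  ModuleHomCoalgebra {
  mhc_coalg : hom_coalgebra Delta eps alpha;
  mhc_mod : hom_module act alpha;
  mhc_act_comul h c :
    Delta (act (h ⊗ c)) =
    \tsum_(h1 ⊗ h2 <- DeltaH h) \tsum_(c1 ⊗ c2 <- Delta c)
       (act (h1 ⊗ c1) ⊗ act (h2 ⊗ c2));
  mhc_act_counit h c : eps (act (h ⊗ c)) = epsH h * eps c }.

Record comodule_hom_algebra (A : lmodType K) (mu : A ⊗ A -> A) (one : A)
    (rho : A -> H ⊗ A) (alpha : A -> A) : Prop := ComoduleHomAlgebra {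
  cha_alg : hom_algebra mu one alpha;
  cha_comod : hom_comodule rho alpha;
  cha_coactM a a' :
    rho (mu (a ⊗ a')) =
    \tsum_(a_1 ⊗ a0 <- rho a) \tsum_(a'_1 ⊗ a'0 <- rho a')
       (muH (a_1 ⊗ a'_1) ⊗ mu (a0 ⊗ a'0));
  cha_coact1 : rho one = oneH ⊗ one }.

Variables (A : lmodType K) (muA : A ⊗ A -> A) (DeltaA : A -> A ⊗ A).
Variables (epsA : A -> K) (alpha : A -> A).
Variables (act : H ⊗ A -> A) (rho : A -> H ⊗ A).

Definition smash_aut (x : A ⊗ H) : A ⊗ H :=
  \tsum_(a ⊗ h <- x) (alpha a ⊗ beta h).

Definition smash_mul (z : (A ⊗ H) ⊗ (A ⊗ H)) : A ⊗ H :=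
  \tsum_(x ⊗ y <- z) \tsum_(a ⊗ h <- x) \tsum_(a' ⊗ h' <- y)
  \tsum_(h1 ⊗ h2 <- DeltaH h)
     (muA (a ⊗ act (h1 ⊗ finv_fun alpha a')) ⊗
      muH (finv_fun beta h2 ⊗ h')).

Definition smash_comul (x : A ⊗ H) : (A ⊗ H) ⊗ (A ⊗ H) :=
  \tsum_(a ⊗ h <- x) \tsum_(a1 ⊗ a2 <- DeltaA a)
  \tsum_(a2_1 ⊗ a20 <- rho a2) \tsum_(h1 ⊗ h2 <- DeltaH h)
     ((a1 ⊗ muH (a2_1 ⊗ finv_fun beta h1)) ⊗ (finv_fun alpha a20 ⊗ h2)).

Definition smash_counit (x : A ⊗ H) : K :=
  \tsum_(a ⊗ h <- x) (epsA a * epsH h).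

End OverH.
End HomStructures.

(* Main.v *)
(* Because the automorphisms are bijective, Hom-structures are ordinary ones
   twisted by an automorphism: x * y := β^-1 (x y) is associative, and
   (β^-1 ⊗ β^-1) Δ is coassociative.  With the action α^-1 (β^2 h ▷ a) and the
   coaction (β ⊗ α^-1) ρ, the Hom-smash product and coproduct untwist to the
   ordinary ones, and (R1)-(R5) to the conditions of Radford's theorem on
   biproducts.  That theorem is a Sweedler computation with
     Δ((a ⊗ h)(b ⊗ g)) = Δ(a ⊗ h) Δ(b ⊗ g):
   (R4) splits Δ_A (a (h_1 · b)), (R1) and (R2) distribute the coaction and the
   action, and (R5) moves a leg of h past the coaction; conversely, applying
   counits to two of the four tensor legs gives back each of these conditions. *)
Require Import Defs.
From HB Require Import structures.
From mathcomp Require Import all_boot all_algebra.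

Set Implicit Arguments.
Unset Strict Implicit.
Unset Printing Implicit Defensive.

Import GRing.Theory.
Local Open Scope ring_scope.

(** * Sweedler calculus *)

Section SweedlerCalculus.
Variable K : fieldType.
Implicit Types U V W X Y : lmodType K.

(** A named constant in place of the notation [linear], so that [lin] can match on it. Scalar-valued
    maps are covered by reading [K] as the module [K^o]. *)
Definition is_linear U V (f : U -> V) : Prop := linear f.

Lemma is_linear_id U : is_linear (fun u : U => u).
Proof. by []. Qed.

Lemma is_linear_comp U V W (g : V -> W) (f : U -> V) :
  is_linear g -> is_linear f -> is_linear (fun u => g (f u)).
Proof. by move=> ling linf k u v; rewrite linf ling. Qed.

Lemma is_linear_pure_l U V W (f : U -> V) (w : W) :
  is_linear f -> is_linear (fun u => f u ⊗ w).
Proof. exact: (is_linear_comp ((pure_bilinear V W).1 w)). Qed.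

Lemma is_linear_pure_r U V W (f : U -> V) (w : W) :
  is_linear f -> is_linear (fun u => w ⊗ f u).
Proof. exact: (is_linear_comp ((pure_bilinear W V).2 w)). Qed.

Lemma is_linear_scale_l U V (f : U -> K^o) (v : V) :
  is_linear f -> is_linear (fun u => f u *: v).
Proof. by move=> linf k u w; rewrite linf scalerDl scalerA. Qed.

Lemma is_linear_scale_r U V (f : U -> V) (c : K) :
  is_linear f -> is_linear (fun u => c *: f u).
Proof.
by move=> linf k u w; rewrite linf scalerDr !scalerA mulrC.
Qed.

Lemma is_linear_mul_l U (f : U -> K^o) (c : K) :
  is_linear f -> is_linear (fun u => f u * c : K^o).
Proof. exact: is_linear_scale_l. Qed.

Lemma is_linear_mul_r U (f : U -> K^o) (c : K) :
  is_linear f -> is_linear (fun u => c * f u : K^o).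
Proof. exact: is_linear_scale_r. Qed.

(** For a fixed tensor, [tsum] is a finite sum over one chosen representative, so linearity of each
    summand is enough. When the variable sits inside the tensor, bilinearity of [F] enters, as in
    [is_linear_tsum_l]. *)
Lemma is_linear_tsum_r U V W X (t : V ⊗ W) (F : U -> V -> W -> X) :
  (forall v w, is_linear (fun u => F u v w)) ->
  is_linear (fun u => tsum t (F u)).
Proof.
move=> linF k u u'; rewrite /tsum scaler_sumr -big_split /=.
by apply: eq_bigr => p _; apply: linF.
Qed.

Lemma is_linear_tsum_l U V W X (t : U -> V ⊗ W) (F : V -> W -> X) :
  (forall w, is_linear (fun v => F v w)) -> (forall v, is_linear (F v)) ->
  is_linear t -> is_linear (fun u => tsum (t u) F).
Proof.
move=> linl linr; apply: (is_linear_comp (g := fun s => tsum s F)).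
by apply: tsum_linear; split.
Qed.

Lemma tsumE U V X (F : U -> V -> X) :
  (forall v, is_linear (fun u => F u v)) -> (forall u, is_linear (F u)) ->
  forall u v, tsum (u ⊗ v) F = F u v.
Proof. by move=> linl linr u v; rewrite tsum_pure. Qed.

Lemma linear_zero U V (g : U -> V) : is_linear g -> g 0 = 0.
Proof. by move/(_ (-1) 0 0); rewrite scaler0 addr0 scaleN1r addNr. Qed.

Lemma linear_sum U V (g : U -> V) (I : Type) (s : seq I) (f : I -> U) :
  is_linear g -> g (\sum_(i <- s) f i) = \sum_(i <- s) g (f i).
Proof.
move=> ling; apply: (big_morph g) => [u u'|].
  by have := ling 1 u u'; rewrite !scale1r.
exact: linear_zero.
Qed.

Lemma linear_scale U V (g : U -> V) (c : K) (u : U) :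
  is_linear g -> g (c *: u) = c *: g u.
Proof.
by move=> ling; have := ling c u 0; rewrite (linear_zero ling) !addr0.
Qed.

Lemma linear_tsum U V X Y (g : X -> Y) (t : U ⊗ V) (F : U -> V -> X) :
  is_linear g -> g (tsum t F) = tsum t (fun u v => g (F u v)).
Proof. exact: linear_sum. Qed.

Lemma scale_tsum U V X (t : U ⊗ V) (c : K) (F : U -> V -> X) :
  tsum t (fun u v => c *: F u v) = c *: tsum t F.
Proof. by rewrite /tsum scaler_sumr. Qed.

Lemma eq_tsum U V (X : nmodType) (t : U ⊗ V) (F G : U -> V -> X) :
  (forall u v, F u v = G u v) -> tsum t F = tsum t G.
Proof. by move=> FG; apply: eq_bigr => p _; apply: FG. Qed.

Lemma exchange_tsum U V X Y Z (s : U ⊗ V) (t : X ⊗ Y)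
    (F : U -> V -> X -> Y -> Z : nmodType) :
  tsum s (fun u v => tsum t (F u v)) =
  tsum t (fun x y => tsum s (fun u v => F u v x y)).
Proof. exact: exchange_big. Qed.

Lemma tsum_id U V (t : U ⊗ V) : tsum t (fun u v => u ⊗ v) = t.
Proof. by rewrite /tsum -tensor_pure. Qed.

Lemma tensor_ind_eq U V W (f g : U ⊗ V -> W) :
  is_linear f -> is_linear g -> (forall u v, f (u ⊗ v) = g (u ⊗ v)) ->
  forall t, f t = g t.
Proof. by move=> linf ling fg t; apply: tensor_ext. Qed.

End SweedlerCalculus.

Create HintDb lin discriminated.
#[global] Hint Resolve is_linear_id : lin.

(* Proves that a Sweedler expression is linear in a variable that occurs once in
   it, by descending along the unique path to that variable. *)
Ltac lin :=
  repeat match goal with |- forall _, _ => intro end;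
  lazymatch goal with
  | |- is_linear (fun u => u) => apply is_linear_id
  | |- is_linear (fun _ => tsum ?t _) =>
      apply is_linear_tsum_r; lin
  | |- is_linear (fun _ => tsum _ ?F) =>
      apply is_linear_tsum_l; lin
  | |- is_linear (fun _ => pure _ ?w) => apply is_linear_pure_l; lin
  | |- is_linear (fun _ => pure ?v _) => apply is_linear_pure_r; lin
  | |- is_linear (fun _ => GRing.scale _ ?w) => apply is_linear_scale_l; lin
  | |- is_linear (fun _ => GRing.scale ?v _) => apply is_linear_scale_r; lin
  | |- is_linear (fun _ => GRing.mul _ ?w) => apply is_linear_mul_l; lin
  | |- is_linear (fun _ => GRing.mul ?v _) => apply is_linear_mul_r; lin
  | |- @is_linear ?K ?U ?W (fun _ => ?g _) =>
      lazymatch goal with |- is_linear (fun u => _ (@?f u)) =>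
        apply (@is_linear_comp K U _ W g f); [solve [auto with lin nocore]|lin]
      end
  | |- @is_linear ?K ?U ?W (fun _ => ?g _ ?c) =>
      lazymatch goal with |- is_linear (fun u => _ (@?f u) _) =>
        apply (@is_linear_comp K U _ W (fun x => g x c) f);
        [solve [auto with lin nocore]|lin]
      end
  | |- @is_linear ?K ?U ?W (fun _ => ?g _ ?c ?d) =>
      lazymatch goal with |- is_linear (fun u => _ (@?f u) _ _) =>
        apply (@is_linear_comp K U _ W (fun x => g x c d) f);
        [solve [auto with lin nocore]|lin]
      end
  | |- is_linear (pure ?v) => apply (is_linear_pure_r v (@is_linear_id _ _))
  | |- is_linear (GRing.scale ?c) =>
      apply (is_linear_scale_r c (@is_linear_id _ _))
  | |- is_linear (GRing.mul ?c) => apply (is_linear_mul_r c (@is_linear_id _ _))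
  | |- ?G => solve [auto with lin nocore]
  end.

(** Abstracts a sum occurring in [t] and uses linearity of its context; an occurrence whose context
    [lin] cannot handle is passed over by backtracking. *)
Ltac hoist t :=
  lazymatch goal with
  | |- ?E = _ =>
    match t with
    | context [@tsum ?K ?U ?V ?W ?s ?F] =>
      let E' := eval pattern (@tsum K U V W s F) in E in
      lazymatch E' with
      | ?g _ => etransitivity;
                [apply (@linear_tsum K U V _ _ g s F); lin|cbv beta]
      end
    end
  end.

Ltac hoist_scale t :=
  lazymatch goal with
  | |- ?E = _ =>
    match t with
    | context [@GRing.scale ?R ?V ?c ?u] =>
      let E' := eval pattern (@GRing.scale R V c u) in E in
      lazymatch E' with
      | ?g _ => etransitivity; [apply (@linear_scale _ V _ g c u); lin|cbv beta]
      end
    end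
  end.

(** Scalars already at the head are skipped: pulling them out again would change nothing and
    [sweedler] would loop. *)
Ltac hoist_inner_scale t :=
  lazymatch t with
  | GRing.scale _ ?t' => hoist_inner_scale t'
  | _ => hoist_scale t
  end.

(* Replaces the left-hand side by an iterated sum whose summand contains no sum:
   sums and scalars are pulled out of linear contexts, pure tensors are
   substituted, and [rw] rewrites the summand and the tensors summed over. *)
Ltac sweedler rw :=
  lazymatch goal with
  | |- @tsum ?K ?U ?V _ (pure ?u ?v) ?F = _ =>
      etransitivity; [apply (@tsumE K U V _ F); lin|cbv beta; sweedler rw]
  | |- tsum ?t _ = _ =>
      first [ hoist t; sweedler rw
            | etransitivity;
              [eapply (@f_equal _ _ (fun s => tsum s _)); progress rw;
               reflexivity
              |cbv beta; sweedler rw]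
            | hoist_scale t; sweedler rw
            | etransitivity;
              [apply eq_tsum; let x := fresh "x" in let y := fresh "y" in
               intros x y; sweedler rw
              |reflexivity]]
  | |- ?t = _ =>
      first [ hoist t; sweedler rw
            | etransitivity; [progress rw; reflexivity|sweedler rw]
            | hoist_inner_scale t; sweedler rw
            | reflexivity ]
  end.

Ltac by_sweedler ops :=
  etransitivity; [sweedler ops|symmetry; etransitivity; [sweedler ops|]];
  rewrite ?tsum_id; reflexivity.

(* Proves [l = r] from [E : l' = r'] when [Phi l'] and [Phi r'] have the same
   normal forms as [l] and [r]. *)
Ltac transport ops Phi E :=
  refine (etrans (esym _) (etrans (congr1 Phi E) _)); cbv beta; by_sweedler ops.

Ltac exchange := refine (exchange_tsum _ _ _).

(* Coassociativity and exchange act on two adjacent sums; [n] is the number of outer sums to descend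
   under before applying such a law. *)
Tactic Notation "lhs_at" int_or_var(n) tactic3(tac) :=
  etransitivity; [do n (apply eq_tsum; intros ? ?); tac|cbv beta].
Tactic Notation "rhs_at" int_or_var(n) tactic3(tac) :=
  symmetry; lhs_at n tac; symmetry.

(** * Ordinary algebras, coalgebras, actions and coactions *)

Section Laws.
Variables (K : fieldType).

Record algebra_laws (U : lmodType K) (m : U -> U -> U) (e : U) : Prop :=
  AlgebraLaws {
  alg_linear_l y : is_linear (fun x => m x y);
  alg_linear_r x : is_linear (m x);
  alg_mulA : associative m;
  alg_mul1l : left_id e m;
  alg_mul1r : right_id e m }.

Record coalgebra_laws (U : lmodType K) (D : U -> U ⊗ U) (eps : U -> K) : Prop :=
  CoalgebraLaws {
  coalg_linear : is_linear D;
  coalg_counit_linear : is_linear (eps : U -> K^o);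
  coalg_comulA c :
    \tsum_(x ⊗ y <- D c) \tsum_(y1 ⊗ y2 <- D y) x ⊗ (y1 ⊗ y2) =
    \tsum_(x ⊗ y <- D c) \tsum_(x1 ⊗ x2 <- D x) x1 ⊗ (x2 ⊗ y);
  coalg_counit_l c : \tsum_(x ⊗ y <- D c) eps x *: y = c;
  coalg_counit_r c : \tsum_(x ⊗ y <- D c) eps y *: x = c }.

Definition multiplicative_comul (U : lmodType K) (m : U -> U -> U)
    (D : U -> U ⊗ U) :=
  forall x y,
    D (m x y) =
    \tsum_(x1 ⊗ x2 <- D x) \tsum_(y1 ⊗ y2 <- D y) m x1 y1 ⊗ m x2 y2.

Record action_laws (H M : lmodType K) (m : H -> H -> H) (e : H)
    (act : H -> M -> M) : Prop := ActionLaws {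
  act_linear_l x : is_linear (fun h => act h x);
  act_linear_r h : is_linear (act h);
  act_mul h k x : act (m h k) x = act h (act k x);
  act_one x : act e x = x }.

Record coaction_laws (H M : lmodType K) (D : H -> H ⊗ H) (eps : H -> K)
    (rho : M -> H ⊗ M) : Prop := CoactionLaws {
  coact_linear : is_linear rho;
  coact_comul x :
    \tsum_(h ⊗ y <- rho x) \tsum_(k ⊗ z <- rho y) h ⊗ (k ⊗ z) =
    \tsum_(h ⊗ y <- rho x) \tsum_(h1 ⊗ h2 <- D h) h1 ⊗ (h2 ⊗ y);
  coact_counit x : \tsum_(h ⊗ y <- rho x) eps h *: y = x }.

Section CoalgebraRules.
Variables (U : lmodType K) (D : U -> U ⊗ U) (eps : U -> K).
Hypothesis coalgU : coalgebra_laws D eps.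
Let linD := coalg_linear coalgU.
Let lineps := coalg_counit_linear coalgU.
Hint Resolve linD lineps : lin.

(** The form used in Sweedler computations: the law between tensors is pushed through the linear map
    [x ⊗ (u ⊗ v) ↦ F x u v]. *)
Lemma comulA (X : lmodType K) (F : U -> U -> U -> X) c :
  (forall y z, is_linear (fun x => F x y z)) ->
  (forall x z, is_linear (fun y => F x y z)) ->
  (forall x y, is_linear (F x y)) ->
  \tsum_(x ⊗ y <- D c) \tsum_(y1 ⊗ y2 <- D y) F x y1 y2 =
  \tsum_(x ⊗ y <- D c) \tsum_(x1 ⊗ x2 <- D x) F x1 x2 y.
Proof.
move=> F1 F2 F3.
transport idtac (fun t => \tsum_(x ⊗ z <- t) \tsum_(u ⊗ v <- z) F x u v)
  (coalg_comulA coalgU c).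
Qed.

Lemma counit_l (X : lmodType K) (F : U -> X) c :
  is_linear F -> \tsum_(x ⊗ y <- D c) eps x *: F y = F c.
Proof.
move=> linF; rewrite -{2}(coalg_counit_l coalgU c) linear_tsum //.
by apply: eq_tsum => x y; rewrite linear_scale.
Qed.

Lemma counit_r (X : lmodType K) (F : U -> X) c :
  is_linear F -> \tsum_(x ⊗ y <- D c) eps y *: F x = F c.
Proof.
move=> linF; rewrite -{2}(coalg_counit_r coalgU c) linear_tsum //.
by apply: eq_tsum => x y; rewrite linear_scale.
Qed.
End CoalgebraRules.

Section CoactionRules.
Variables (H M : lmodType K) (D : H -> H ⊗ H) (eps : H -> K) (rho : M -> H ⊗ M).
Hypothesis lawsM : coaction_laws D eps rho.
Let linr := coact_linear lawsM.
Hint Resolve linr : lin.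

Lemma coact_comulA (X : lmodType K) (F : H -> H -> M -> X) c :
  (forall y z, is_linear (fun x => F x y z)) ->
  (forall x z, is_linear (fun y => F x y z)) ->
  (forall x y, is_linear (F x y)) ->
  \tsum_(h ⊗ y <- rho c) \tsum_(k ⊗ z <- rho y) F h k z =
  \tsum_(h ⊗ y <- rho c) \tsum_(h1 ⊗ h2 <- D h) F h1 h2 y.
Proof.
move=> F1 F2 F3.
transport idtac (fun t => \tsum_(x ⊗ z <- t) \tsum_(u ⊗ v <- z) F x u v)
  (coact_comul lawsM c).
Qed.

Lemma coact_counitE (X : lmodType K) (F : M -> X) c :
  is_linear F -> \tsum_(h ⊗ y <- rho c) eps h *: F y = F c.
Proof.
move=> linF; rewrite -{2}(coact_counit lawsM c) linear_tsum //.
by apply: eq_tsum => x y; rewrite linear_scale.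
Qed.
End CoactionRules.

End Laws.

(** * The biproduct theorem for ordinary bialgebras *)

Section Smash.
Variables (K : fieldType) (H A : lmodType K).
Variables (mH : H -> H -> H) (oneH : H) (DH : H -> H ⊗ H) (epsH : H -> K).
Variables (mA : A -> A -> A) (oneA : A) (DA : A -> A ⊗ A) (epsA : A -> K).
Variables (act : H -> A -> A) (rho : A -> H ⊗ A).

Hypothesis algH : algebra_laws mH oneH.
Hypothesis coalgH : coalgebra_laws DH epsH.
Hypothesis comulHM : multiplicative_comul mH DH.
Hypothesis comulH1 : DH oneH = oneH ⊗ oneH.
Hypothesis counitHM : forall h k, epsH (mH h k) = epsH h * epsH k.
Hypothesis counitH1 : epsH oneH = 1.
Hypothesis algA : algebra_laws mA oneA.
Hypothesis coalgA : coalgebra_laws DA epsA.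
Hypothesis actA : action_laws mH oneH act.
Hypothesis actM : forall h a b,
  act h (mA a b) = \tsum_(h1 ⊗ h2 <- DH h) mA (act h1 a) (act h2 b).
Hypothesis act1 : forall h, act h oneA = epsH h *: oneA.
Hypothesis coactA : coaction_laws DH epsH rho.
Hypothesis coactD : forall a,
  \tsum_(h ⊗ x <- rho a) \tsum_(x1 ⊗ x2 <- DA x) h ⊗ (x1 ⊗ x2) =
  \tsum_(a1 ⊗ a2 <- DA a) \tsum_(h ⊗ x <- rho a1) \tsum_(k ⊗ y <- rho a2)
    mH h k ⊗ (x ⊗ y).
Hypothesis coact_eps : forall a,
  \tsum_(h ⊗ x <- rho a) epsA x *: h = epsA a *: oneH.

Let mHl := alg_linear_l algH.
Let mHr := alg_linear_r algH.
Let mAl := alg_linear_l algA.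
Let mAr := alg_linear_r algA.
Let actl := act_linear_l actA.
Let actr := act_linear_r actA.
Let linDH := coalg_linear coalgH.
Let linDA := coalg_linear coalgA.
Let linepsH := coalg_counit_linear coalgH.
Let linepsA := coalg_counit_linear coalgA.
Let linrho := coact_linear coactA.
Hint Resolve mHl mHr mAl mAr actl actr linDH linDA linepsH linepsA linrho : lin.

Lemma coact_comulE (X : lmodType K) (F : H -> A -> A -> X) a :
  (forall y z, is_linear (fun x => F x y z)) ->
  (forall x z, is_linear (fun y => F x y z)) ->
  (forall x y, is_linear (F x y)) ->
  \tsum_(h ⊗ x <- rho a) \tsum_(x1 ⊗ x2 <- DA x) F h x1 x2 =
  \tsum_(a1 ⊗ a2 <- DA a) \tsum_(h ⊗ x <- rho a1) \tsum_(k ⊗ y <- rho a2)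
    F (mH h k) x y.
Proof.
move=> F1 F2 F3.
transport idtac (fun t => \tsum_(x ⊗ z <- t) \tsum_(u ⊗ v <- z) F x u v)
  (coactD a).
Qed.

Lemma coact_epsE (X : lmodType K) (F : H -> X) a :
  is_linear F -> \tsum_(h ⊗ x <- rho a) epsA x *: F h = epsA a *: F oneH.
Proof.
move=> linF; rewrite -[RHS]linear_scale // -coact_eps linear_tsum //.
by apply: eq_tsum => h x; rewrite linear_scale.
Qed.

(** * The smash product algebra and the smash coproduct coalgebra *)

Definition smash_prod (x y : A ⊗ H) : A ⊗ H :=
  \tsum_(a ⊗ h <- x) \tsum_(b ⊗ g <- y) \tsum_(h1 ⊗ h2 <- DH h)
    mA a (act h1 b) ⊗ mH h2 g.

Definition smash_coprod (x : A ⊗ H) : (A ⊗ H) ⊗ (A ⊗ H) :=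
  \tsum_(a ⊗ h <- x) \tsum_(a1 ⊗ a2 <- DA a) \tsum_(k ⊗ a0 <- rho a2)
  \tsum_(h1 ⊗ h2 <- DH h) (a1 ⊗ mH k h1) ⊗ (a0 ⊗ h2).

Definition smash_eps (x : A ⊗ H) : K :=
  \tsum_(a ⊗ h <- x) (epsA a * epsH h : K^o).

Lemma smash_prodE a h b g :
  smash_prod (a ⊗ h) (b ⊗ g) =
  \tsum_(h1 ⊗ h2 <- DH h) mA a (act h1 b) ⊗ mH h2 g.
Proof. rewrite /smash_prod; by sweedler idtac. Qed.

Lemma smash_coprodE a h :
  smash_coprod (a ⊗ h) = \tsum_(a1 ⊗ a2 <- DA a) \tsum_(k ⊗ a0 <- rho a2)
  \tsum_(h1 ⊗ h2 <- DH h) (a1 ⊗ mH k h1) ⊗ (a0 ⊗ h2).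
Proof. rewrite /smash_coprod; by sweedler idtac. Qed.

Lemma smash_epsE a h : smash_eps (a ⊗ h) = epsA a * epsH h.
Proof. by apply: (@tsumE _ _ _ K^o); lin. Qed.

Lemma smash_prod_linear_l y : is_linear (fun x => smash_prod x y).
Proof. rewrite /smash_prod; lin. Qed.
Lemma smash_prod_linear_r x : is_linear (smash_prod x).
Proof. rewrite /smash_prod; lin. Qed.
Lemma smash_coprod_linear : is_linear smash_coprod.
Proof. rewrite /smash_coprod; lin. Qed.
Lemma smash_eps_linear : is_linear (smash_eps : _ -> K^o).
Proof. rewrite /smash_eps; lin. Qed.
Hint Resolve smash_prod_linear_l smash_prod_linear_r : lin.
Hint Resolve smash_coprod_linear smash_eps_linear : lin.

(** The normal form: comultiplications and actions distributed over products, products associated to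
    the right, and products of scalars split into iterated scalings so that each counit can be
    consumed separately. *)
Ltac ops := rewrite ?smash_prodE ?smash_coprodE ?smash_epsE ?comulHM ?comulH1
  ?actM ?act1 ?counitHM ?(act_mul actA) ?(act_one actA)
  -?(alg_mulA algA) -?(alg_mulA algH) ?(alg_mul1l algA) ?(alg_mul1r algA)
  ?(alg_mul1l algH) ?(alg_mul1r algH) -?scalerA ?counitH1 ?scale1r.
Ltac norm := sweedler ltac:(ops).
Ltac bynorm := etransitivity; [norm|symmetry; etransitivity; [norm|symmetry]].
Ltac on_pure t := move: t; apply: tensor_ind_eq; [lin|lin|].

(** The module algebra law splits [h1] on the left and multiplicativity of [DH] splits [h2] on the
    right. Both sides then have three legs of [h], and they differ by coassociativity of [DH]. *)
Lemma smash_mulA : associative smash_prod.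
Proof.
move=> x y z; on_pure x => a h; on_pure y => b g; on_pure z => c k.
bynorm.
rewrite exchange_tsum [RHS](comulA coalgH); try lin.
by apply: eq_tsum => h1 h2; rewrite exchange_tsum.
Qed.

Lemma smash_mul1l : left_id (oneA ⊗ oneH) smash_prod.
Proof. by move=> x; on_pure x => a h; etransitivity; [norm|]. Qed.

Lemma smash_mul1r : right_id (oneA ⊗ oneH) smash_prod.
Proof.
move=> x; on_pure x => a h; etransitivity; [norm|].
by apply: (counit_l coalgH); lin.
Qed.

Lemma smash_comulA x :
  \tsum_(u ⊗ v <- smash_coprod x) \tsum_(v1 ⊗ v2 <- smash_coprod v)
    u ⊗ (v1 ⊗ v2) =
  \tsum_(u ⊗ v <- smash_coprod x) \tsum_(u1 ⊗ u2 <- smash_coprod u)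
    u1 ⊗ (u2 ⊗ v).
Proof.
on_pure x => a h.
bynorm.
lhs_at 2 (exchange).
(* The comodule coalgebra law trades the comultiplication of [a_{2,0}] for coactions on the two legs
   of [a_2]. *)
lhs_at 1 (apply: coact_comulE; lin).
lhs_at 4 (exchange).
(* An iterated coaction becomes [DH] on the leg in [H], which is what [DH (mH k h1)] produces on the
   right. *)
lhs_at 3 (apply: (coact_comulA coactA); lin).
lhs_at 5 (apply: (comulA coalgH); lin).
rhs_at 2 (exchange).
rhs_at 1 (exchange).
rhs_at 0 (symmetry; apply: (comulA coalgA); lin).
bynorm.
rhs_at 3 exchange.
rhs_at 2 exchange.
rhs_at 4 exchange.
by [].
Qed.

Lemma smash_counit_l c : \tsum_(x ⊗ y <- smash_coprod c) smash_eps x *: y = c.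
Proof.
on_pure c => a h; etransitivity; [norm|].
lhs_at 2 (rewrite !scale_tsum (counit_l coalgH); [reflexivity|lin]).
lhs_at 1 (rewrite scale_tsum (coact_counitE coactA); [reflexivity|lin]).
by apply: (counit_l coalgA); lin.
Qed.

Lemma smash_counit_r c : \tsum_(x ⊗ y <- smash_coprod c) smash_eps y *: x = c.
Proof.
on_pure c => a h; etransitivity; [norm|].
lhs_at 2 (rewrite !scale_tsum (counit_r coalgH); [reflexivity|lin]).
lhs_at 1 (rewrite coact_epsE; [reflexivity|lin]).
rewrite (counit_r coalgA); last by lin.
by rewrite (alg_mul1l algH).
Qed.

Lemma smash_algebra : algebra_laws smash_prod (oneA ⊗ oneH).
Proof.
split; [exact: smash_prod_linear_l|exact: smash_prod_linear_r|exact: smash_mulA|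
  exact: smash_mul1l|exact: smash_mul1r].
Qed.

Lemma smash_coalgebra : coalgebra_laws smash_coprod smash_eps.
Proof.
split; [exact: smash_coprod_linear|exact: smash_eps_linear|exact: smash_comulA|
  exact: smash_counit_l|exact: smash_counit_r].
Qed.

Definition coact_multiplicative := forall a b,
  rho (mA a b) =
  \tsum_(h ⊗ x <- rho a) \tsum_(k ⊗ y <- rho b) mH h k ⊗ mA x y.
Definition act_comultiplicative := forall h a,
  DA (act h a) =
  \tsum_(h1 ⊗ h2 <- DH h) \tsum_(a1 ⊗ a2 <- DA a) act h1 a1 ⊗ act h2 a2.
(** [DA] is multiplicative for the product on [A ⊗ A] twisted by the braiding
    [a ⊗ b ↦ (a_{-1} · b) ⊗ a_0]. *)
Definition braided_multiplicative := forall a b,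
  DA (mA a b) =
  \tsum_(a1 ⊗ a2 <- DA a) \tsum_(h ⊗ x <- rho a2) \tsum_(b1 ⊗ b2 <- DA b)
    mA a1 (act h b1) ⊗ mA x b2.
(** The left-left Yetter-Drinfeld compatibility in its antipode-free form, as [H] is only a
    bialgebra. *)
Definition yetter_drinfeld := forall a h,
  \tsum_(h1 ⊗ h2 <- DH h) \tsum_(k ⊗ x <- rho a) mH h1 k ⊗ act h2 x =
  \tsum_(h1 ⊗ h2 <- DH h) \tsum_(k ⊗ x <- rho (act h1 a)) mH k h2 ⊗ x.

(** * Sufficiency of Radford's conditions *)

Section Sufficiency.
Hypothesis coactM : coact_multiplicative.
Hypothesis act_comul : act_comultiplicative.
Hypothesis comulAM : braided_multiplicative.
Hypothesis yd : yetter_drinfeld.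

Lemma yetter_drinfeldE (X : lmodType K) (F : H -> A -> X) a h :
  (forall x, is_linear (fun k => F k x)) -> (forall k, is_linear (F k)) ->
  \tsum_(h1 ⊗ h2 <- DH h) \tsum_(k ⊗ x <- rho (act h1 a)) F (mH k h2) x =
  \tsum_(h1 ⊗ h2 <- DH h) \tsum_(k ⊗ x <- rho a) F (mH h1 k) (act h2 x).
Proof.
move=> F1 F2.
transport idtac (fun t => \tsum_(k ⊗ x <- t) F k x) (esym (yd a h)).
Qed.

Lemma smash_comulM : multiplicative_comul smash_prod smash_coprod.
Proof.
(* The Yetter-Drinfeld relation with the summand [F] spelled out in the shape in which it occurs
   below. *)
have ydE p l q r (s d t : A) :
    \tsum_(p1 ⊗ p2 <- DH p) \tsum_(k ⊗ x <- rho (act p1 s))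
    \tsum_(r1 ⊗ r2 <- DH r)
      d ⊗ mH l (mH (mH k p2) r1) ⊗ (mA t x ⊗ mH q r2) =
  \tsum_(p1 ⊗ p2 <- DH p) \tsum_(k ⊗ x <- rho s) \tsum_(r1 ⊗ r2 <- DH r)
      d ⊗ mH l (mH (mH p1 k) r1) ⊗ (mA t (act p2 x) ⊗ mH q r2).
  by apply: (yetter_drinfeldE (F := fun k x => \tsum_(r1 ⊗ r2 <- DH r)
      d ⊗ mH l (mH k r1) ⊗ (mA t x ⊗ mH q r2))); lin.
move=> x y; on_pure x => a h; on_pure y => b g.
etransitivity; [sweedler ltac:(ops; rewrite ?coactM ?comulAM ?act_comul)|].
symmetry; etransitivity; [norm|symmetry].
lhs_at 0 exchange.
lhs_at 1 exchange.
lhs_at 4 exchange.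
lhs_at 3 exchange.
lhs_at 2 exchange.
(* The coaction on [a_2] from the braided law and the one on [a_{2,0}] from the smash coproduct
   merge into one coaction followed by [DH]. *)
lhs_at 1 (apply: (coact_comulA coactA); lin).
(* The legs of [h] are regrouped until the leg acting on [b_2] and the leg multiplied onto the
   resulting coaction come from a single [DH], as [ydE] requires. *)
lhs_at 3 (symmetry; apply: (comulA coalgH); lin).
lhs_at 6 exchange.
lhs_at 5 exchange.
lhs_at 4 (apply: (comulA coalgH); lin).
lhs_at 5 exchange.
lhs_at 9 (rewrite [X in mH _ X](alg_mulA algH); reflexivity).
lhs_at 6 (apply: ydE).
lhs_at 5 exchange.
(* The four legs of [h] are regrouped into the pairs [h_{11}, h_{12}] and [h_{21}, h_{22}] of the
   right-hand side. *)
lhs_at 4 (symmetry; apply: (comulA coalgH); lin).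
lhs_at 3 (apply: (comulA coalgH); lin).
rhs_at 5 exchange.
rhs_at 4 exchange.
rhs_at 3 exchange.
rhs_at 2 exchange.
rhs_at 6 exchange.
rhs_at 5 exchange.
rhs_at 4 exchange.
rhs_at 7 exchange.
rhs_at 6 exchange.
rhs_at 5 exchange.
by bynorm.
Qed.
End Sufficiency.

(** * Necessity of Radford's conditions *)

Section Necessity.
Hypothesis comulM : multiplicative_comul smash_prod smash_coprod.
Hypothesis comul1 : smash_coprod (oneA ⊗ oneH) = (oneA ⊗ oneH) ⊗ (oneA ⊗ oneH).
Hypothesis counitM : forall x y,
  smash_eps (smash_prod x y) = smash_eps x * smash_eps y.
Hypothesis counit1 : smash_eps (oneA ⊗ oneH) = 1.

Lemma counitA1 : epsA oneA = 1.
Proof. by move: counit1; rewrite smash_epsE counitH1 mulr1. Qed.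

(** Comes from multiplicativity of the counit on [(a ⊗ h)(b ⊗ oneH)]. Setting [a = oneA] yields
    [act_counit], and [h = oneH] yields [counitAM]. *)
Lemma counit_actM a h b : epsA (mA a (act h b)) = epsA a * (epsH h * epsA b).
Proof.
have := counitM (a ⊗ h) (b ⊗ oneH).
rewrite !smash_epsE counitH1 mulr1 -mulrA => <-.
rewrite smash_prodE (linear_tsum (Y := K^o)); last by lin.
rewrite -(counit_r coalgH (X := K^o) (F := fun k => epsA (mA a (act k b))));
  last by lin.
apply: (@eq_tsum _ _ _ K^o) => h1 h2; rewrite smash_epsE (alg_mul1r algH).
by rewrite [LHS]mulrC.
Qed.

Lemma act_counit h b : epsA (act h b) = epsH h * epsA b.
Proof.
by have := counit_actM oneA h b; rewrite (alg_mul1l algA) counitA1 mul1r.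
Qed.

Lemma counitAM a b : epsA (mA a b) = epsA a * epsA b.
Proof.
by have := counit_actM a oneH b; rewrite (act_one actA) counitH1 mul1r.
Qed.

(** [epsH] on the last leg of [comul1] leaves one equation containing both [DA oneA] and the
    coaction: [epsA] on its first leg then gives [coact_one], and [epsH] on its middle leg gives
    [comul_one]. *)
Lemma comul_one_coact :
  \tsum_(x ⊗ y <- DA oneA) \tsum_(k ⊗ z <- rho y) x ⊗ (k ⊗ z) =
  oneA ⊗ (oneH ⊗ oneA).
Proof.
have := congr1 (fun t => \tsum_(x ⊗ y <- t) \tsum_(a ⊗ h <- x)
   \tsum_(b ⊗ g <- y) epsH g *: (a ⊗ (h ⊗ b))) comul1.
move=> /= E; etransitivity; [symmetry|etransitivity; [exact: E|]]; norm.
Qed.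

Lemma coact_one : rho oneA = oneH ⊗ oneA.
Proof.
have := congr1 (fun t => \tsum_(x ⊗ y <- t) epsA x *: y) comul_one_coact.
move=> /= E; etransitivity; [symmetry|etransitivity; [exact: E|]].
  etransitivity; [norm|].
  lhs_at 1 (rewrite scale_tsum tsum_id; reflexivity).
  by apply: (counit_l coalgA); lin.
by etransitivity; [norm|rewrite counitA1 scale1r].
Qed.

Lemma comul_one : DA oneA = oneA ⊗ oneA.
Proof.
have := congr1
  (fun t => \tsum_(x ⊗ y <- t) \tsum_(h ⊗ z <- y) epsH h *: (x ⊗ z))
  comul_one_coact.
move=> /= E; etransitivity; [symmetry|etransitivity; [exact: E|norm]].
etransitivity; [norm|].
lhs_at 1 (apply: (coact_counitE coactA); lin).
by rewrite tsum_id.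
Qed.

Ltac norm' :=
  sweedler ltac:(ops; rewrite ?comul_one ?coact_one ?counitAM ?act_counit
    ?counitA1 ?scale1r).

(** The product [(oneA ⊗ h)(b ⊗ oneH)] isolates the action of [h] on [b]. Killing both legs in [H]
    leaves its comultiplication; killing the outer two legs, in the next lemma, leaves the
    Yetter-Drinfeld relation. *)
Lemma act_comul_of_smash : act_comultiplicative.
Proof.
move=> h b.
have := congr1 (fun t => \tsum_(u ⊗ v <- t) \tsum_(c ⊗ k <- u)
   \tsum_(d ⊗ l <- v) epsH k *: (epsH l *: (c ⊗ d)))
  (comulM (oneA ⊗ h) (b ⊗ oneH)).
move=> /= E; etransitivity; [symmetry|etransitivity; [exact: E|]].
  etransitivity; [norm'|].
  lhs_at 3 (rewrite !scale_tsum (counit_l coalgH); [reflexivity|lin]).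
  lhs_at 2 (apply: (coact_counitE coactA); lin).
  lhs_at 1 (rewrite scale_tsum tsum_id; reflexivity).
  by apply: (counit_r coalgH (F := fun x => DA (act x b))); lin.
etransitivity; [norm'|].
lhs_at 4 (rewrite !scale_tsum (counit_r coalgH); [reflexivity|lin]).
lhs_at 3 (apply: (counit_r coalgH); lin).
by lhs_at 2 (apply: (coact_counitE coactA); lin).
Qed.

Lemma yetter_drinfeld_of_smash : yetter_drinfeld.
Proof.
move=> b h.
have := congr1 (fun t => \tsum_(u ⊗ v <- t) \tsum_(c ⊗ k <- u)
   \tsum_(d ⊗ l <- v) epsA c *: (epsH l *: (k ⊗ d)))
  (comulM (oneA ⊗ h) (b ⊗ oneH)).
move=> /= E; symmetry; etransitivity; [symmetry|etransitivity; [exact: E|]].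
  etransitivity; [norm'|].
  lhs_at 3 (rewrite !scale_tsum (counit_r coalgH); [reflexivity|lin]).
  lhs_at 2 (apply: scale_tsum).
  by lhs_at 1 (apply: (counit_l coalgA); lin).
etransitivity; [norm'|].
lhs_at 4 (rewrite !scale_tsum (counit_r coalgH); [reflexivity|lin]).
lhs_at 3 (apply: (counit_l coalgH); lin).
lhs_at 2 (apply: scale_tsum).
by lhs_at 1 (apply: (counit_l coalgA); lin).
Qed.

(** The product [(a ⊗ oneH)(b ⊗ oneH)] isolates the multiplication of [A]. Killing both legs in [H]
    gives the braided law; killing the outer two legs gives [coactM_of_smash]. *)
Lemma braided_of_smash : braided_multiplicative.
Proof.
move=> a b.
have := congr1 (fun t => \tsum_(u ⊗ v <- t) \tsum_(c ⊗ k <- u)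
   \tsum_(d ⊗ l <- v) epsH k *: (epsH l *: (c ⊗ d)))
  (comulM (a ⊗ oneH) (b ⊗ oneH)).
move=> /= E; etransitivity; [symmetry|etransitivity; [exact: E|]].
  etransitivity; [norm'|].
  lhs_at 1 (apply: (coact_counitE coactA); lin).
  by rewrite tsum_id.
etransitivity; [norm'|].
lhs_at 4 (apply: (counit_r coalgH); lin).
by lhs_at 3 (apply: (coact_counitE coactA); lin).
Qed.

Lemma coactM_of_smash : coact_multiplicative.
Proof.
move=> a b.
have := congr1 (fun t => \tsum_(u ⊗ v <- t) \tsum_(c ⊗ k <- u)
   \tsum_(d ⊗ l <- v) epsA c *: (epsH l *: (k ⊗ d)))
  (comulM (a ⊗ oneH) (b ⊗ oneH)).
move=> /= E; etransitivity; [symmetry|etransitivity; [exact: E|]].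
  etransitivity; [norm'|].
  lhs_at 1 (rewrite scale_tsum tsum_id; reflexivity).
  by apply: (counit_l coalgA); lin.
etransitivity; [norm'|].
lhs_at 4 (rewrite !scale_tsum (counit_l coalgH); [reflexivity|lin]).
lhs_at 3 (rewrite !scale_tsum; reflexivity).
lhs_at 2 (rewrite !scale_tsum (counit_l coalgA); [reflexivity|lin]).
lhs_at 1 (apply: scale_tsum).
by apply: (counit_l coalgA); lin.
Qed.

End Necessity.

Record radford_conditions : Prop := RadfordConditions {
  rad_coactM : coact_multiplicative;
  rad_coact1 : rho oneA = oneH ⊗ oneA;
  rad_act_comul : act_comultiplicative;
  rad_act_counit h a : epsA (act h a) = epsH h * epsA a;
  rad_counitM a b : epsA (mA a b) = epsA a * epsA b;
  rad_counit1 : epsA oneA = 1;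
  rad_comul1 : DA oneA = oneA ⊗ oneA;
  rad_braided : braided_multiplicative;
  rad_yd : yetter_drinfeld }.

Lemma smash_epsM : radford_conditions ->
  forall x y, smash_eps (smash_prod x y) = smash_eps x * smash_eps y.
Proof.
case=> _ _ _ actE epsM _ _ _ _ x y; move: x.
apply: (@tensor_ind_eq _ _ _ K^o) => [||a h]; [lin|lin|].
move: y; apply: (@tensor_ind_eq _ _ _ K^o) => [||b g]; [lin|lin|].
rewrite !smash_epsE smash_prodE (linear_tsum (Y := K^o)); last by lin.
(* Puts [epsH u] in scalar position, the shape to which [counit_l] applies. *)
transitivity (\tsum_(u ⊗ v <- DH h)
    (epsH u *: (epsA a * epsA b * (epsH v * epsH g) : K^o))).
  apply: (@eq_tsum _ _ _ K^o) => u v; rewrite smash_epsE epsM actE counitHM.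
  by rewrite [epsA a * _]mulrCA -[LHS]mulrA.
rewrite (counit_l coalgH (X := K^o)
  (F := fun v => epsA a * epsA b * (epsH v * epsH g))); last by lin.
exact: mulrACA.
Qed.

Lemma radford : 
  [/\ multiplicative_comul smash_prod smash_coprod,
    smash_coprod (oneA ⊗ oneH) = (oneA ⊗ oneH) ⊗ (oneA ⊗ oneH),
    forall x y, smash_eps (smash_prod x y) = smash_eps x * smash_eps y
   & smash_eps (oneA ⊗ oneH) = 1] <-> radford_conditions.
Proof.
split=> [[M U C I]|R].
  split.
  - exact: coactM_of_smash.
  - exact: coact_one.
  - exact: act_comul_of_smash.
  - exact: act_counit.
  - exact: counitAM.
  - exact: counitA1.
  - exact: comul_one.
  - exact: braided_of_smash.
  - exact: yetter_drinfeld_of_smash.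
have C := smash_epsM R.
case: R => R1 R2 R3 R4 R5 R6 R7 R8 R9; split=> //.
- exact: smash_comulM.
- by etransitivity; [sweedler ltac:(ops; rewrite ?R7 ?R2)|].
- by rewrite smash_epsE R6 counitH1 mulr1.
Qed.

End Smash.

(** * Untwisting Hom-structures *)

Lemma finv_linear (K : fieldType) (U : lmodType K) (f : U -> U) :
  is_linear f -> bijective f -> is_linear (finv_fun f).
Proof.
move=> linf /finvK[fK fgK] k u v.
by apply: (can_inj fK); rewrite linf !fgK.
Qed.

Lemma eq_is_linear (K : fieldType) (U V : lmodType K) (f g : U -> V) :
  f =1 g -> is_linear f -> is_linear g.
Proof. by move=> fg linf k u v; rewrite -!fg linf. Qed.

Local Notation twice f := (fun x => f (f x)).
Local Notation tmap f g := (fun t => \tsum_(x ⊗ y <- t) f x ⊗ g y).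

Section Twist.
Variables (K : fieldType) (U : lmodType K).
Variables (mu : U ⊗ U -> U) (e : U) (Delta : U -> U ⊗ U) (eps : U -> K).
Variables (al al' : U -> U) (m : U -> U -> U) (D : U -> U ⊗ U).
Hypothesis lin_al : is_linear al.
Hypothesis lin_al' : is_linear al'.
Hypothesis alK : cancel al al'.
Hypothesis al'K : cancel al' al.
(** [m] and [D] are tied to the Hom-structure by equations instead of being defined from it: on
    [A ⊗ H] their roles are played by [smash_prod] and [smash_coprod]. *)
Hypothesis muE : forall x y, mu (x ⊗ y) = al (m x y).
Hypothesis DeltaE : forall x, Delta x = \tsum_(x1 ⊗ x2 <- D x) al x1 ⊗ al x2.
Hint Resolve lin_al lin_al' : lin.

Lemma untwist_mulE x y : m x y = al' (mu (x ⊗ y)).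
Proof. by rewrite muE alK. Qed.

Lemma untwist_mul_linear : is_linear mu ->
  (forall y, is_linear (fun x => m x y)) /\ (forall x, is_linear (m x)).
Proof.
move=> linmu; split=> z.
  by apply: eq_is_linear (fun x => esym (untwist_mulE x z)) _; lin.
by apply: eq_is_linear (fun x => esym (untwist_mulE z x)) _; lin.
Qed.

Lemma untwist_comulE x : D x = \tsum_(x1 ⊗ x2 <- Delta x) al' x1 ⊗ al' x2.
Proof. by rewrite DeltaE; by_sweedler ltac:(rewrite ?alK). Qed.

Lemma untwist_comul_linear : is_linear Delta -> is_linear D.
Proof.
by move=> linD; apply: eq_is_linear (fun x => esym (untwist_comulE x)) _; lin.
Qed.

Lemma untwist_autM :
  (forall x y, al (mu (x ⊗ y)) = mu (al x ⊗ al y)) ->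
  forall x y, al (m x y) = m (al x) (al y).
Proof. by move=> autM x y; rewrite [RHS]untwist_mulE -autM muE !alK. Qed.

Lemma inv_autM : (forall x y, al (m x y) = m (al x) (al y)) ->
  forall x y, al' (m x y) = m (al' x) (al' y).
Proof. by move=> autM x y; apply: (can_inj alK); rewrite autM !al'K. Qed.

Lemma untwist_aut_comul : is_linear Delta ->
  (forall x, Delta (al x) = \tsum_(x1 ⊗ x2 <- Delta x) al x1 ⊗ al x2) ->
  forall x, D (al x) = \tsum_(x1 ⊗ x2 <- D x) al x1 ⊗ al x2.
Proof.
move=> /untwist_comul_linear linD autD x; rewrite untwist_comulE autD DeltaE.
by_sweedler ltac:(rewrite ?alK).
Qed.

Lemma inv_aut_comul : is_linear D ->
  (forall x, D (al x) = \tsum_(x1 ⊗ x2 <- D x) al x1 ⊗ al x2) ->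
  forall x, D (al' x) = \tsum_(x1 ⊗ x2 <- D x) al' x1 ⊗ al' x2.
Proof.
move=> linD autD x; rewrite -{2}(al'K x) autD.
by_sweedler ltac:(rewrite ?alK).
Qed.

(** Once [al] is moved outwards, Hom-associativity is associativity with [al] applied twice, and the
    Hom-unit laws are the unit laws with [al] applied once; [al] is injective. *)
Lemma untwist_algebra : hom_algebra mu e al -> algebra_laws m e.
Proof.
move=> homU; have [ml mr] := untwist_mul_linear (hom_mul_linear homU).
have autM := untwist_autM (hom_alg_autM homU).
split=> // [x y z|x|x].
- have := hom_mulA homU x y z; rewrite !muE -!autM.
  by move=> /(can_inj alK)/(can_inj alK).
- by have := hom_mul1r homU x; rewrite muE => /(can_inj alK).
- by have := hom_mulr1 homU x; rewrite muE => /(can_inj alK).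
Qed.

Lemma twist_algebra : is_linear mu -> algebra_laws m e ->
  (forall x y, al (m x y) = m (al x) (al y)) -> al e = e ->
  hom_algebra mu e al.
Proof.
move=> linmu algU autM aut1; split=> // [|x y|x y z|x|x].
- by exists al'.
- by rewrite !muE -!autM.
- by rewrite !muE -!autM (alg_mulA algU).
- by rewrite muE (alg_mul1r algU).
- by rewrite muE (alg_mul1l algU).
Qed.

Lemma untwist_coalgebra : hom_coalgebra Delta eps al -> coalgebra_laws D eps.
Proof.
move=> homU; have linDelta := hom_comul_linear homU.
have linD := untwist_comul_linear linDelta.
have autD := untwist_aut_comul linDelta (hom_comul_aut homU).
have auteps := hom_counit_aut homU.
have lineps : is_linear (eps : U -> K^o) := hom_counit_linear homU.
split=> // x.
- transport ltac:(rewrite ?DeltaE ?autD ?alK)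
     (tmap (twice al') (tmap (twice al') (twice al')))
    (hom_comulA homU x).
- transport ltac:(rewrite ?DeltaE ?auteps ?alK) al' (hom_counitl homU x).
- transport ltac:(rewrite ?DeltaE ?auteps ?alK) al' (hom_counitr homU x).
Qed.

Lemma twist_coalgebra : is_linear Delta -> coalgebra_laws D eps ->
  (forall x, D (al x) = \tsum_(x1 ⊗ x2 <- D x) al x1 ⊗ al x2) ->
  (forall x, eps (al x) = eps x) ->
  hom_coalgebra Delta eps al.
Proof.
move=> linDelta coalgU autD auteps; have linD := coalg_linear coalgU.
have lineps := coalg_counit_linear coalgU.
split=> // [|x|x|x|x].
- by exists al'.
- by_sweedler ltac:(rewrite ?DeltaE ?autD).
- transport ltac:(rewrite ?DeltaE ?autD)
     (tmap (twice al) (tmap (twice al) (twice al)))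
    (coalg_comulA coalgU x).
- transport ltac:(rewrite ?DeltaE ?auteps) al (coalg_counit_l coalgU x).
- transport ltac:(rewrite ?DeltaE ?auteps) al (coalg_counit_r coalgU x).
Qed.

(** As [al] commutes with [m] and [D], the Hom-compatibility of product and coproduct is the
    ordinary one with [al] applied twice to each leg. It serves to untwist [H] and, in both
    directions, to compare the two structures on [A ⊗ H]. *)
Lemma twist_bialgebra : is_linear mu -> is_linear Delta ->
  algebra_laws m e -> coalgebra_laws D eps ->
  (forall x y, al (m x y) = m (al x) (al y)) -> al e = e ->
  (forall x, D (al x) = \tsum_(x1 ⊗ x2 <- D x) al x1 ⊗ al x2) ->
  (forall x, eps (al x) = eps x) ->
  hom_bialgebra mu e Delta eps al <->
  [/\ multiplicative_comul m D, D e = e ⊗ e,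
      forall x y, eps (m x y) = eps x * eps y & eps e = 1].
Proof.
move=> linmu linDelta algU coalgU autM aut1 autD auteps.
have linD := coalg_linear coalgU.
have ml := alg_linear_l algU; have mr := alg_linear_r algU.
have autM' := inv_autM autM.
split=> [homU|[DM D1 epsM eps1]].
  split=> [x y||x y|].
  - transport ltac:(rewrite ?DeltaE ?muE ?autD ?autM ?autM' ?alK)
       (tmap (twice al') (twice al'))
      (hom_comulM homU x y).
  - by rewrite -aut1 autD -DeltaE (hom_comul1 homU) aut1.
  - by rewrite -(hom_counitM homU) muE auteps.
  - exact: hom_counit1 homU.
split=> [||x y||x y|//].
- exact: twist_algebra.
- exact: twist_coalgebra.
- transport ltac:(rewrite ?DeltaE ?muE ?autD ?autM ?autM' ?alK)
     (tmap (twice al) (twice al)) (DM x y).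
- by rewrite DeltaE -autD aut1.
- by rewrite muE auteps.
Qed.

End Twist.

(** * Untwisting the given structures on [H] and [A] *)

Section Main.
Variables (K : fieldType) (H : lmodType K) (muH : H ⊗ H -> H) (oneH : H)
    (DeltaH : H -> H ⊗ H) (epsH : H -> K) (beta : H -> H)
    (A : lmodType K) (muA : A ⊗ A -> A) (oneA : A)
    (DeltaA : A -> A ⊗ A) (epsA : A -> K) (alpha : A -> A)
    (hact : H ⊗ A -> A) (hrho : A -> H ⊗ A).
Hypothesis bialgH : hom_bialgebra muH oneH DeltaH epsH beta.
Hypothesis modalgA :
   module_hom_algebra muH oneH DeltaH epsH beta muA oneA hact alpha.
Hypothesis comodcoalgA :
   comodule_hom_coalgebra muH oneH DeltaH epsH beta DeltaA epsA hrho alpha.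
Variables (mH : H -> H -> H) (DH : H -> H ⊗ H).
Variables (mA : A -> A -> A) (DA : A -> A ⊗ A).
Variables (act : H -> A -> A) (rho : A -> H ⊗ A).
Local Notation beta' := (finv_fun beta).
Local Notation alpha' := (finv_fun alpha).
Hypothesis muHE : forall x y, muH (x ⊗ y) = beta (mH x y).
Hypothesis DeltaHE : forall x,
  DeltaH x = \tsum_(x1 ⊗ x2 <- DH x) beta x1 ⊗ beta x2.
Hypothesis muAE : forall x y, muA (x ⊗ y) = alpha (mA x y).
Hypothesis DeltaAE : forall x,
  DeltaA x = \tsum_(x1 ⊗ x2 <- DA x) alpha x1 ⊗ alpha x2.
(* With these powers of [beta], [smash_mul] and [smash_comul] untwist to
   [smash_prod] and [smash_coprod]. *)
Hypothesis hactE : forall h x, hact (h ⊗ x) = alpha (act (beta' (beta' h)) x).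
Hypothesis hrhoE : forall x, hrho x = \tsum_(k ⊗ z <- rho x) beta' k ⊗ alpha z.

Let homH := hom_bialg_alg bialgH.
Let cohomH := hom_bialg_coalg bialgH.
Let homA := mha_alg modalgA.
Let cohomA := chc_coalg comodcoalgA.
Let modA := mha_mod modalgA.
Let comodA := chc_comod comodcoalgA.
Let linb : is_linear beta := hom_alg_aut_linear homH.
Let lina : is_linear alpha := hom_alg_aut_linear homA.
Let linb' : is_linear beta' := finv_linear linb (hom_alg_aut_bij homH).
Let lina' : is_linear alpha' := finv_linear lina (hom_alg_aut_bij homA).
Let bK : cancel beta beta' := (finvK (hom_alg_aut_bij homH)).1.
Let b'K : cancel beta' beta := (finvK (hom_alg_aut_bij homH)).2.
Let aK : cancel alpha alpha' := (finvK (hom_alg_aut_bij homA)).1.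
Let a'K : cancel alpha' alpha := (finvK (hom_alg_aut_bij homA)).2.
Hint Resolve linb lina linb' lina' : lin.

Let algH := untwist_algebra linb' bK muHE homH.
Let algA := untwist_algebra lina' aK muAE homA.
Let coalgH := untwist_coalgebra linb linb' bK DeltaHE cohomH.
Let coalgA := untwist_coalgebra lina lina' aK DeltaAE cohomA.
Let mHl := alg_linear_l algH.
Let mHr := alg_linear_r algH.
Let mAl := alg_linear_l algA.
Let mAr := alg_linear_r algA.
Let linDH := coalg_linear coalgH.
Let linDA := coalg_linear coalgA.
Let linepsH := coalg_counit_linear coalgH.
Let linepsA := coalg_counit_linear coalgA.
Hint Resolve mHl mHr mAl mAr linDH linDA linepsH linepsA : lin.

Let bM := untwist_autM bK muHE (hom_alg_autM homH).
Let b'M := inv_autM bK b'K bM.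
Let b1 := hom_alg_aut1 homH.
Let b'1 : beta' oneH = oneH. Proof. by rewrite -{1}b1 bK. Qed.
Let bD := untwist_aut_comul linb linb' bK DeltaHE
  (hom_comul_linear cohomH) (hom_comul_aut cohomH).
Let b'D x : DH (beta' x) = \tsum_(x1 ⊗ x2 <- DH x) beta' x1 ⊗ beta' x2.
Proof. exact: inv_aut_comul bD x. Qed.
Let beps := hom_counit_aut cohomH.
Let b'eps h : epsH (beta' h) = epsH h. Proof. by rewrite -beps b'K. Qed.
Let aM := untwist_autM aK muAE (hom_alg_autM homA).
Let a'M := inv_autM aK a'K aM.
Let a1 := hom_alg_aut1 homA.
Let a'1 : alpha' oneA = oneA. Proof. by rewrite -{1}a1 aK. Qed.
Let aD := untwist_aut_comul lina lina' aK DeltaAE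
  (hom_comul_linear cohomA) (hom_comul_aut cohomA).
Let a'D x : DA (alpha' x) = \tsum_(x1 ⊗ x2 <- DA x) alpha' x1 ⊗ alpha' x2.
Proof. exact: inv_aut_comul aD x. Qed.
Let aeps := hom_counit_aut cohomA.
Let a'eps h : epsA (alpha' h) = epsA h. Proof. by rewrite -aeps a'K. Qed.

Let linhact : is_linear hact := hom_act_linear modA.
Let linhrho : is_linear hrho := hom_coact_linear comodA.
Let linmuH : is_linear muH := hom_mul_linear homH.
Let linmuA : is_linear muA := hom_mul_linear homA.
Let linDeltaH : is_linear DeltaH := hom_comul_linear cohomH.
Let linDeltaA : is_linear DeltaA := hom_comul_linear cohomA.
Hint Resolve linhact linhrho linmuH linmuA linDeltaH linDeltaA : lin.

Let actE h x : act h x = alpha' (hact (beta (beta h) ⊗ x)).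
Proof. by rewrite hactE !bK aK. Qed.
Let rhoE x : rho x = \tsum_(k ⊗ z <- hrho x) beta k ⊗ alpha' z.
Proof. by rewrite hrhoE; by_sweedler ltac:(rewrite ?b'K ?aK). Qed.
Let actl x : is_linear (fun h => act h x).
Proof. by apply: eq_is_linear (fun h => esym (actE h x)) _; lin. Qed.
Let actr h : is_linear (act h).
Proof. by apply: eq_is_linear (fun x => esym (actE h x)) _; lin. Qed.
Let linrho : is_linear rho.
Proof. by apply: eq_is_linear (fun x => esym (rhoE x)) _; lin. Qed.
Hint Resolve actl actr linrho : lin.

Let aact h x : alpha (act h x) = act (beta h) (alpha x).
Proof. by rewrite !actE -(hom_act_aut modA) a'K aK. Qed.
Let a'act h x : alpha' (act h x) = act (beta' h) (alpha' x).
Proof. by apply: (can_inj aK); rewrite aact !a'K b'K. Qed.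
Let arho x : rho (alpha x) = \tsum_(k ⊗ z <- rho x) beta k ⊗ alpha z.
Proof.
rewrite rhoE (hom_coact_aut comodA) hrhoE.
by_sweedler ltac:(rewrite ?b'K ?aK).
Qed.
Let a'rho x : rho (alpha' x) = \tsum_(k ⊗ z <- rho x) beta' k ⊗ alpha' z.
Proof.
by rewrite -{2}(a'K x) arho; by_sweedler ltac:(rewrite ?bK ?aK).
Qed.

(* The automorphisms are moved out of [DH], [DA] and [rho] before being
   distributed over products and actions: nothing is known of [DA (mA a b)]. *)
Ltac ops := rewrite ?muHE ?DeltaHE ?muAE ?DeltaAE ?hactE ?hrhoE
  ?bK ?b'K ?aK ?a'K ?bD ?b'D ?aD ?a'D ?arho ?a'rho
  ?beps ?b'eps ?aeps ?a'eps ?b1 ?b'1 ?a1 ?a'1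
  ?bM ?b'M ?aM ?a'M ?aact ?a'act.

(** In this and the following laws, [ops] collects the same powers of the automorphisms on both
    sides of the Hom-law, and the map given to [transport] cancels them. The arguments
    [beta (beta h)] offset the inverse powers in [hactE]. *)
Let actlaws : action_laws mH oneH act.
Proof.
split=> // [h k x|x].
- transport ltac:(ops) (twice alpha') 
    (esym (hom_actA modA (beta (beta h)) (beta (beta k)) x)).
- transport ltac:(ops) (finv_fun alpha) (hom_act1 modA x).
Qed.

Let coactlaws : coaction_laws DH epsH rho.
Proof.
split=> // x.
- transport ltac:(ops)
    (tmap (fun h : H => h) (tmap (fun h : H => h) (twice alpha')))
   (hom_coactA comodA x).
- transport ltac:(ops) (finv_fun alpha) (hom_coact_counit comodA x).
Qed.

Let actM h a b :
  act h (mA a b) = \tsum_(h1 ⊗ h2 <- DH h) mA (act h1 a) (act h2 b).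
Proof.
(* One [beta] suffices here: the left side then acts by [beta^3 h], and [DeltaHE] supplies the
   second [beta] on the legs of [h], so both sides are [alpha^2] of the ordinary ones. *)
have /= E := mha_actM modalgA (beta h) a b.
transport ltac:(ops) (twice alpha') E.
Qed.

Let act1 h : act h oneA = epsH h *: oneA.
Proof.
transport ltac:(ops) (finv_fun alpha) (mha_act1 modalgA (beta (beta h))).
Qed.

Let coactD a :
  \tsum_(h ⊗ x <- rho a) \tsum_(x1 ⊗ x2 <- DA x) h ⊗ (x1 ⊗ x2) =
  \tsum_(a1 ⊗ a2 <- DA a) \tsum_(h ⊗ x <- rho a1) \tsum_(k ⊗ y <- rho a2)
    mH h k ⊗ (x ⊗ y).
Proof.
have /= E := chc_coact_comul comodcoalgA a.
transport ltac:(ops)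
    (tmap beta' (tmap (twice alpha') (twice alpha')))
   E.
Qed.

Let coact_eps a : \tsum_(h ⊗ x <- rho a) epsA x *: h = epsA a *: oneH.
Proof.
transport ltac:(ops) beta (chc_coact_counit comodcoalgA a).
Qed.

Let bialgHlaws :=
  (twist_bialgebra linb linb' bK b'K muHE DeltaHE linmuH linDeltaH algH coalgH
    bM b1 bD beps).1 bialgH.
Let comulHM : multiplicative_comul mH DH. Proof. by case: bialgHlaws. Qed.
Let comulH1 : DH oneH = oneH ⊗ oneH. Proof. by case: bialgHlaws. Qed.
Let counitHM h k : epsH (mH h k) = epsH h * epsH k.
Proof. by case: bialgHlaws. Qed.
Let counitH1 : epsH oneH = 1. Proof. by case: bialgHlaws. Qed.

(** Each Hom-condition is its ordinary counterpart with equal powers of the automorphisms on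
    corresponding legs; the structure axioms contained in (R1) and (R2) come from the standing
    hypotheses. *)
Lemma radford_conditionsP :
  [/\ comodule_hom_algebra muH oneH DeltaH epsH beta muA oneA hrho alpha,
      module_hom_coalgebra muH oneH DeltaH epsH beta DeltaA epsA hact alpha,
      [/\ forall a b : A, epsA (muA (a ⊗ b)) = epsA a * epsA b,
          epsA oneA = 1 & DeltaA oneA = oneA ⊗ oneA],
      forall a b : A,
        DeltaA (muA (a ⊗ b)) =
        \tsum_(a1 ⊗ a2 <- DeltaA a) \tsum_(a2_1 ⊗ a20 <- hrho a2)
        \tsum_(b1 ⊗ b2 <- DeltaA b)
          muA (a1 ⊗ hact (iter 2 beta a2_1 ⊗ finv_fun alpha b1)) ⊗
          muA (finv_fun alpha a20 ⊗ b2)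
    & forall (a : A) (h : H),
        \tsum_(h1 ⊗ h2 <- DeltaH h) \tsum_(a_1 ⊗ a0 <- hrho a)
          muH (h1 ⊗ beta a_1) ⊗ hact (iter 3 beta h2 ⊗ a0) =
        \tsum_(h1 ⊗ h2 <- DeltaH h)
        \tsum_(x_1 ⊗ x0 <- hrho (hact (iter 2 beta h1 ⊗ a)))
          muH (x_1 ⊗ h2) ⊗ x0]
  <-> radford_conditions mH oneH DH epsH mA oneA DA epsA act rho.
Proof.
split=> [[R1 R2 [R3 R4 R5] R6 R7]|[R1 R2 R3 R4 R5 R6 R7 R8 R9]].
  split=> //.
  - move=> a b.
    transport ltac:(ops) (tmap (fun h : H => h) (twice alpha'))
      (cha_coactM R1 a b).
  - transport ltac:(ops) (tmap beta alpha') (cha_coact1 R1).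
  - move=> h a.
    transport ltac:(ops) (tmap (twice alpha') (twice alpha'))
      (mhc_act_comul R2 (beta (beta h)) a).
  - move=> h a; have := mhc_act_counit R2 (beta (beta h)) a.
    by rewrite hactE !bK aeps !beps.
  - by move=> a b; rewrite -R3 muAE aeps.
  - by rewrite -a1 aD -DeltaAE R5 a1.
  - move=> a b; have /= E := R6 a b.
    transport ltac:(ops) (tmap (twice alpha') (twice alpha')) E.
  (* [beta' h] absorbs the [beta] that [DeltaHE] puts on each leg; both sides then carry [beta] on
     [H] and [alpha^2] on [A]. *)
  - move=> a h; have /= E := R7 a (beta' h).
    transport ltac:(ops) (tmap beta' (twice alpha')) E.
split.
- split=> // [a b|].
  + transport ltac:(ops) (tmap (fun h : H => h) (twice alpha)) (R1 a b).
  + transport ltac:(ops) (tmap beta' alpha) R2.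
- split=> // [h a|h a].
  + transport ltac:(ops) (tmap (twice alpha) (twice alpha))
      (R3 (beta' (beta' h)) a).
  + by rewrite hactE aeps R4 !b'eps.
- split=> // [a b|]; first by rewrite muAE aeps R5.
  by rewrite DeltaAE -aD a1.
- move=> a b /=.
  transport ltac:(ops) (tmap (twice alpha) (twice alpha)) (R8 a b).
- move=> a h /=.
  transport ltac:(ops) (tmap beta (twice alpha)) (R9 a (beta h)).
Qed.

(** * The Hom-smash product and coproduct as twists of the ordinary ones *)

Definition smash_aut_inv (x : A ⊗ H) : A ⊗ H :=
  \tsum_(a ⊗ h <- x) alpha' a ⊗ beta' h.

Local Notation gamma := (smash_aut beta alpha).
Local Notation smash_prod := (smash_prod mH DH mA act).
Local Notation smash_coprod := (smash_coprod mH DH DA rho).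

Lemma smash_autE a h : gamma (a ⊗ h) = alpha a ⊗ beta h.
Proof. by rewrite /smash_aut; etransitivity; [sweedler idtac|]. Qed.

Lemma smash_aut_linear : is_linear gamma.
Proof. by rewrite /smash_aut; lin. Qed.
Lemma smash_aut_inv_linear : is_linear smash_aut_inv.
Proof. by rewrite /smash_aut_inv; lin. Qed.
Hint Resolve smash_aut_linear smash_aut_inv_linear : lin.

Lemma smash_autK : cancel gamma smash_aut_inv.
Proof.
apply: tensor_ind_eq; [lin|lin|move=> a h].
by rewrite /smash_aut /smash_aut_inv; etransitivity; [sweedler ltac:(ops)|].
Qed.

Lemma smash_aut_invK : cancel smash_aut_inv gamma.
Proof.
apply: tensor_ind_eq; [lin|lin|move=> a h].
by rewrite /smash_aut /smash_aut_inv; etransitivity; [sweedler ltac:(ops)|].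
Qed.

Let hom_prod := smash_mul muH DeltaH beta muA alpha hact.
Let hom_coprod := smash_comul muH DeltaH beta DeltaA alpha hrho.

Lemma hom_prod_linear : is_linear hom_prod.
Proof. by rewrite /hom_prod /smash_mul; lin. Qed.
Lemma hom_coprod_linear : is_linear hom_coprod.
Proof. by rewrite /hom_coprod /smash_comul; lin. Qed.

Let lin_sl y : is_linear (fun x => smash_prod x y).
Proof. by apply: smash_prod_linear_l; eassumption. Qed.
Let lin_sr x : is_linear (smash_prod x).
Proof. by apply: smash_prod_linear_r; eassumption. Qed.
Let lin_sc : is_linear smash_coprod.
Proof. by apply: smash_coprod_linear; eassumption. Qed.
Hint Resolve hom_prod_linear hom_coprod_linear lin_sl lin_sr lin_sc : lin.

Let smE a h b g : smash_prod (a ⊗ h) (b ⊗ g) =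
  \tsum_(h1 ⊗ h2 <- DH h) mA a (act h1 b) ⊗ mH h2 g.
Proof. by apply: smash_prodE; eassumption. Qed.
Let scE a h : smash_coprod (a ⊗ h) =
  \tsum_(a1 ⊗ a2 <- DA a) \tsum_(k ⊗ a0 <- rho a2) \tsum_(h1 ⊗ h2 <- DH h)
    (a1 ⊗ mH k h1) ⊗ (a0 ⊗ h2).
Proof. by apply: smash_coprodE; eassumption. Qed.

(** By [hactE], [hact (beta h1 ⊗ alpha' b)] equals [act h1 b], so only the outer [alpha] and [beta]
    of [muA] and [muH] survive, and these form [gamma]. *)
Lemma hom_prodE x y : hom_prod (x ⊗ y) = gamma (smash_prod x y).
Proof.
move: x; apply: tensor_ind_eq; [lin|lin|move=> a h].
move: y; apply: tensor_ind_eq; [lin|lin|move=> b g].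
rewrite /hom_prod /smash_mul.
by_sweedler ltac:(rewrite ?smE ?smash_autE; ops).
Qed.

(** [hrho (alpha a2)] has legs [k] and [alpha^2 a0]; [alpha'] removes one [alpha], leaving a single
    automorphism on each of the four legs. *)
Lemma hom_coprodE x :
  hom_coprod x = \tsum_(u ⊗ v <- smash_coprod x) gamma u ⊗ gamma v.
Proof.
move: x; apply: tensor_ind_eq; [lin|lin|move=> a h].
rewrite /hom_coprod /smash_comul.
by_sweedler ltac:(rewrite ?scE ?smash_autE; ops).
Qed.

Lemma smash_prod_aut x y :
  gamma (smash_prod x y) = smash_prod (gamma x) (gamma y).
Proof.
move: x; apply: tensor_ind_eq; [lin|lin|move=> a h].
move: y; apply: tensor_ind_eq; [lin|lin|move=> b g].
by_sweedler ltac:(rewrite ?smE ?smash_autE; ops).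
Qed.

Lemma smash_coprod_aut x :
  smash_coprod (gamma x) = \tsum_(u ⊗ v <- smash_coprod x) gamma u ⊗ gamma v.
Proof.
move: x; apply: tensor_ind_eq; [lin|lin|move=> a h].
by_sweedler ltac:(rewrite ?scE ?smash_autE; ops).
Qed.

Lemma smash_eps_aut x : smash_eps epsH epsA (gamma x) = smash_eps epsH epsA x.
Proof.
have lins := smash_eps_linear coalgH coalgA.
move: x; apply: (@tensor_ind_eq _ _ _ K^o) => [||a h]; [lin|lin|].
have smash_epsE b g : smash_eps epsH epsA (b ⊗ g) = epsA b * epsH g.
  by apply: smash_epsE; eassumption.
by rewrite smash_autE !smash_epsE aeps beps.
Qed.

(** Untwisting by [gamma] reduces the Hom-bialgebra axioms to the four compatibilities between the
    ordinary smash product and coproduct, which [radford] characterizes. *)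
Lemma hom_radford :
  hom_bialgebra hom_prod (oneA ⊗ oneH) hom_coprod (smash_eps epsH epsA) gamma
  <->
  radford_conditions mH oneH DH epsH mA oneA DA epsA act rho.
Proof.
refine (iff_trans _ _); last by apply: radford; eassumption.
apply: (twist_bialgebra smash_aut_linear smash_aut_inv_linear smash_autK
  smash_aut_invK hom_prodE hom_coprodE hom_prod_linear hom_coprod_linear).
- by apply: smash_algebra; eassumption.
- by apply: smash_coalgebra; eassumption.
- exact: smash_prod_aut.
- by rewrite smash_autE a1 b1.
- exact: smash_coprod_aut.
- exact: smash_eps_aut.
Qed.

End Main.

Theorem theorem3p3 (K : fieldType)
    (H : lmodType K) (muH : H ⊗ H -> H) (oneH : H)
    (DeltaH : H -> H ⊗ H) (epsH : H -> K) (beta : H -> H)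
    (A : lmodType K) (muA : A ⊗ A -> A) (oneA : A)
    (DeltaA : A -> A ⊗ A) (epsA : A -> K) (alpha : A -> A)
    (act : H ⊗ A -> A) (rho : A -> H ⊗ A)
    (bialgH : hom_bialgebra muH oneH DeltaH epsH beta)
    (modalgA :
       module_hom_algebra muH oneH DeltaH epsH beta muA oneA act alpha)
    (comodcoalgA :
       comodule_hom_coalgebra muH oneH DeltaH epsH beta DeltaA epsA rho alpha) :
  hom_bialgebra (smash_mul muH DeltaH beta muA alpha act) (oneA ⊗ oneH)
    (smash_comul muH DeltaH beta DeltaA alpha rho) (smash_counit epsH epsA)
    (smash_aut beta alpha)
  <->
  [/\ comodule_hom_algebra muH oneH DeltaH epsH beta muA oneA rho alpha,
      module_hom_coalgebra muH oneH DeltaH epsH beta DeltaA epsA act alpha,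
      [/\ forall a b : A, epsA (muA (a ⊗ b)) = epsA a * epsA b,
          epsA oneA = 1 & DeltaA oneA = oneA ⊗ oneA],
      forall a b : A,
        DeltaA (muA (a ⊗ b)) =
        \tsum_(a1 ⊗ a2 <- DeltaA a) \tsum_(a2_1 ⊗ a20 <- rho a2)
        \tsum_(b1 ⊗ b2 <- DeltaA b)
          muA (a1 ⊗ act (iter 2 beta a2_1 ⊗ finv_fun alpha b1)) ⊗
          muA (finv_fun alpha a20 ⊗ b2)
    & forall (a : A) (h : H),
        \tsum_(h1 ⊗ h2 <- DeltaH h) \tsum_(a_1 ⊗ a0 <- rho a)
          muH (h1 ⊗ beta a_1) ⊗ act (iter 3 beta h2 ⊗ a0) =
        \tsum_(h1 ⊗ h2 <- DeltaH h)
        \tsum_(x_1 ⊗ x0 <- rho (act (iter 2 beta h1 ⊗ a)))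
          muH (x_1 ⊗ h2) ⊗ x0].
Proof.
have linb := hom_alg_aut_linear (hom_bialg_alg bialgH).
have [bK b'K] := finvK (hom_alg_aut_bij (hom_bialg_alg bialgH)).
have lina := hom_alg_aut_linear (mha_alg modalgA).
have [aK a'K] := finvK (hom_alg_aut_bij (mha_alg modalgA)).
have linb' := finv_linear linb (hom_alg_aut_bij (hom_bialg_alg bialgH)).
have lina' := finv_linear lina (hom_alg_aut_bij (mha_alg modalgA)).
(* The ordinary operations, found by solving the equations assumed in [hom_radford] for them. *)
pose mH x y := finv_fun beta (muH (x ⊗ y)).
pose mA x y := finv_fun alpha (muA (x ⊗ y)).
pose DH x := \tsum_(x1 ⊗ x2 <- DeltaH x) finv_fun beta x1 ⊗ finv_fun beta x2.
pose DA x := \tsum_(x1 ⊗ x2 <- DeltaA x) finv_fun alpha x1 ⊗ finv_fun alpha x2.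
pose ac h x := finv_fun alpha (act (beta (beta h) ⊗ x)).
pose r x := \tsum_(k ⊗ z <- rho x) beta k ⊗ finv_fun alpha z.
have muHE x y : muH (x ⊗ y) = beta (mH x y) by rewrite /mH b'K.
have muAE x y : muA (x ⊗ y) = alpha (mA x y) by rewrite /mA a'K.
have DeltaHE x : DeltaH x = \tsum_(x1 ⊗ x2 <- DH x) beta x1 ⊗ beta x2.
  by rewrite /DH; by_sweedler ltac:(rewrite ?b'K).
have DeltaAE x : DeltaA x = \tsum_(x1 ⊗ x2 <- DA x) alpha x1 ⊗ alpha x2.
  by rewrite /DA; by_sweedler ltac:(rewrite ?a'K).
have actE h x :
    act (h ⊗ x) = alpha (ac (finv_fun beta (finv_fun beta h)) x).
  by rewrite /ac a'K !b'K.
have rhoE x : rho x = \tsum_(k ⊗ z <- r x) finv_fun beta k ⊗ alpha z.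
  by rewrite /r; by_sweedler ltac:(rewrite ?bK ?a'K).
(* [smash_counit] and [smash_eps] are identified by conversion. *)
apply: iff_trans
  (hom_radford bialgH modalgA comodcoalgA muHE DeltaHE muAE DeltaAE actE rhoE)
  (iff_sym (radford_conditionsP bialgH modalgA comodcoalgA
    muHE DeltaHE muAE DeltaAE actE rhoE)).
Qed.
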